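(* Let $N\ge 3$ and $p>p_S$. There exists a positive function $u^*\in C^2(0,\infty)$ satisfying \[ u''+\frac{N-1}{s}u'+f(u)=0\quad (0<s<\infty),\qquad u(s)\to\infty\ \ (s\downarrow 0). \] The function $u^*$ oscillates around $1$; in particular it has infinitely many critical points $0<s_1^*<s_2^*<\cdots\to\infty$. Moreover, $u(s,\gamma)\to u^*(s)$ in $C^0_{loc}(0,\infty)$ as $\gamma\to\infty$.
   Context: $N\ge3$, $p_S:=\frac{N+2}{N-2}$, and $f(u):=-u+u^p$. For $\gamma>0$, $u(s,\gamma)$ denotes the solution of the initial value problem $u''+\frac{N-1}{s}u'+f(u)=0$ ($s>0$), $u(0)=\gamma$, $u'(0)=0$ (it exists, is positive, and is defined for all $s\ge 0$). *)

(* Defs.v *)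
From Stdlib Require Import Reals Lra.
Open Scope R_scope.

Definition fnl (p u : R) : R := - u + Rpower u p.

Definition pS (N : nat) : R := (INR N + 2) / (INR N - 2).

Definition radial_ode (N : nat) (p : R) (u du ddu : R -> R) : Prop :=
  forall s, 0 < s ->
    derivable_pt_lim u s (du s) /\
    derivable_pt_lim du s (ddu s) /\
    ddu s + (INR N - 1) / s * du s + fnl p (u s) = 0.

(* u is the (positive) solution of the initial value problem
   u'' + (N-1)/s u' + f(u) = 0 (s>0), u(0) = gamma, u'(0) = 0,
   i.e. u is C^2 on (0,oo) and u, u' extend continuously to s = 0
   with u(0) = gamma and u'(0) = 0. *)
Definition ivp_sol (N : nat) (p gamma : R) (u : R -> R) : Prop :=
  u 0 = gamma /\
  (forall s, 0 <= s -> 0 < u s) /\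
  exists du ddu : R -> R,
    radial_ode N p u du ddu /\
    (forall eps, 0 < eps -> exists delta, 0 < delta /\
       forall s, 0 < s < delta -> Rabs (u s - gamma) < eps /\ Rabs (du s) < eps).

(* Main.v *)
Require Import Defs.
From Stdlib Require Import Reals Lra Lia Psatz ClassicalChoice Ranalysis5.
From Coquelicot Require Import Coquelicot.
Open Scope R_scope.

(* Put th = 2/(p-1), t = ln s and y(t) = s^th u(s).  The equation becomes
   y'' + al y' + y (y^(p-1) - a) = e^(2t) y with al = N-2-2th and a = th (N-2-th), and al > 0
   exactly when p > p_S.  The Hamiltonian
   H = y'^2/2 - (a + e^(2t)) y^2/2 + y^(p+1)/(p+1) is nonincreasing along every solution.
   Near s = 0 the solution u(.,gamma) stays close to gamma up to a radius of order
   gamma^(-(p-1)/2), where H <= -d with d > 0 independent of gamma; hence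
   H <= -d from a time tau(gamma) -> -oo on, which bounds y above and below.
   Damping then brings (y, y') close to the equilibrium (A, 0), A^(p-1) = a, on
   [tau(gamma) + L, T], where any two solutions approach each other exponentially, so the
   family is Cauchy at T as gamma -> oo, and by Gronwall on every compact interval.
   The limit is u*.  It inherits H <= -d, so u* is singular at 0, and
   u* >= c s^(-th-1) at infinity, which rules out decay to 0; Riccati blow-up for u* - 1
   excludes any other non-oscillating behaviour. *)

(* [auto_derive] leaves derivatives of unknown functions in eta-expanded form. *)
Ltac subst_derive H :=
  match type of H with
  | is_derive ?f ?x ?l =>
    replace (Derive (fun z : R => f z) x) with l
      by (symmetry; exact (is_derive_unique _ _ _ H))
  end.

(** Supercriticality enters twice through [al]: as damping, and through [a - th^2 = th * al]. On the
    plateau where [u] is about [gamma] one has [y'] about [th * y], so the quadratic part of the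
    Hamiltonian is about [- th * al * y^2 / 2]. The power term is small beside it when
    [gamma^(p-1) s^2] is small, and the scaling [y = s^th u] makes the size of [y] at that moment
    independent of [gamma]: this is the source of [d]. Compactness alone would give subsequential
    limits; convergence of the whole family comes from comparing two members directly. In their
    difference the forcing leaves only the linear term [e^(2t) (y1 - y2)], harmless to the
    contraction while [e^(2t)] is small. At the start of the contraction interval nothing better
    than a bounded difference is known; smallness comes only from the length of that interval, which
    can be taken as long as desired because [tau(gamma)] tends to -oo. *)

Lemma deriv_nonpos_le (f df : R -> R) (a b : R) :
  a <= b -> (forall x, a <= x <= b -> is_derive f x (df x)) ->
  (forall x, a <= x <= b -> df x <= 0) -> f b <= f a.
Proof.
intros Hab Hf Hdf.
destruct (Req_dec a b) as [<-|Hne]; [lra|].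
destruct (MVT_cor2 f df a b) as [c [Hc Hc']]; [lra| |].
- intros x Hx; apply is_derive_Reals, Hf, Hx.
- assert (df c <= 0) by (apply Hdf; lra). nra.
Qed.

Lemma deriv_nonneg_le (f df : R -> R) (a b : R) :
  a <= b -> (forall x, a <= x <= b -> is_derive f x (df x)) ->
  (forall x, a <= x <= b -> 0 <= df x) -> f a <= f b.
Proof.
intros Hab Hf Hdf.
destruct (Req_dec a b) as [<-|Hne]; [lra|].
destruct (MVT_cor2 f df a b) as [c [Hc Hc']]; [lra| |].
- intros x Hx; apply is_derive_Reals, Hf, Hx.
- assert (0 <= df c) by (apply Hdf; lra). nra.
Qed.

(** Monotonicity of [W * exp (- k * x)]. The rate [k] may be negative, which turns the estimate into
    exponential decay. *)
Lemma gronwall_le (W dW : R -> R) (k a b : R) :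
  a <= b -> (forall x, a <= x <= b -> is_derive W x (dW x)) ->
  (forall x, a <= x <= b -> dW x <= k * W x) ->
  W b <= W a * exp (k * (b - a)).
Proof.
intros Hab HW HdW.
assert (H : W b * exp (- k * b) <= W a * exp (- k * a)).
{ apply (deriv_nonpos_le (fun x => W x * exp (- k * x))
    (fun x => (dW x - k * W x) * exp (- k * x)) a b Hab).
  - intros x Hx. pose proof (HW x Hx) as H1.
    auto_derive; [eexists; exact H1|].
    subst_derive H1. ring.
  - intros x Hx. pose proof (HdW x Hx). pose proof (exp_pos (- k * x)). nra. }
replace (k * (b - a)) with (- k * a + k * b) by ring.
rewrite exp_plus.
replace (W b) with (W b * exp (- k * b) * exp (k * b)).
2:{ rewrite Rmult_assoc, <- exp_plus. replace (- k * b + k * b) with 0 by ring.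
    rewrite exp_0; ring. }
rewrite <- Rmult_assoc. apply Rmult_le_compat_r; [left; apply exp_pos|exact H].
Qed.

Lemma gronwall_decay (W dW : R -> R) (c D a b : R) :
  0 < c -> 0 <= D -> a <= b ->
  (forall x, a <= x <= b -> is_derive W x (dW x)) ->
  (forall x, a <= x <= b -> dW x <= - c * W x + D) ->
  W b <= W a * exp (- c * (b - a)) + D / c.
Proof.
intros Hc HD Hab HW HdW.
assert (H : W b - D / c <= (W a - D / c) * exp (- c * (b - a))).
{ apply (gronwall_le (fun x => W x - D / c) dW); auto.
  - intros x Hx. pose proof (HW x Hx) as H1.
    auto_derive; [eexists; exact H1|].
    subst_derive H1. ring.
  - intros x Hx. pose proof (HdW x Hx) as H1.
    replace (- c * (W x - D / c)) with (- c * W x + D) by (field; lra). exact H1. }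
pose proof (exp_pos (- c * (b - a))).
assert (0 <= D / c) by (apply Rle_div_r; lra). nra.
Qed.

(** * Real powers: monotonicity, bounds and a mean value formula *)

Lemma Rpower_pos (x r : R) : 0 < Rpower x r.
Proof. apply exp_pos. Qed.

Lemma is_derive_Rpower (r x : R) :
  0 < x -> is_derive (fun x => Rpower x r) x (r * Rpower x (r - 1)).
Proof. intros Hx; apply is_derive_Reals, derivable_pt_lim_power, Hx. Qed.

Lemma Rpower_S (x r : R) : 0 < x -> Rpower x (r + 1) = x * Rpower x r.
Proof. intros Hx; rewrite Rpower_plus, Rpower_1; [ring|exact Hx]. Qed.

Lemma Rpower_le_l_neg (x y r : R) : 0 < x <= y -> r <= 0 -> Rpower y r <= Rpower x r.
Proof.
intros Hx Hr.
replace r with (- - r) by ring. rewrite (Rpower_Ropp y), (Rpower_Ropp x).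
apply Rinv_le_contravar; [apply Rpower_pos|apply Rle_Rpower_l; lra].
Qed.

(** Applied to exponents such as [p - 2], which can have either sign; hence the two monotonicity
    cases. *)
Lemma Rpower_bounds (m M r : R) : 0 < m -> exists c C, 0 < c /\ 0 < C /\
  forall x, m <= x <= M -> c <= Rpower x r <= C.
Proof.
intros Hm. destruct (Rle_lt_dec 0 r) as [Hr|Hr].
- exists (Rpower m r), (Rpower M r).
  repeat split; try apply Rpower_pos; apply Rle_Rpower_l; lra.
- exists (Rpower M r), (Rpower m r).
  repeat split; try apply Rpower_pos; apply Rpower_le_l_neg; lra.
Qed.

Lemma Rpower_sub_MVT (r x y : R) : 0 < x -> 0 < y ->
  exists z, Rmin x y <= z <= Rmax x y /\
    Rpower y r - Rpower x r = r * Rpower z (r - 1) * (y - x).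
Proof.
intros Hx Hy.
assert (Hz : forall z, Rmin x y <= z -> 0 < z).
{ intros z Hz. revert Hz; unfold Rmin; destruct Rle_dec; lra. }
destruct (MVT_gen (fun z => Rpower z r) x y (fun z => r * Rpower z (r - 1)))
  as [z [Hz1 Hz2]].
- intros z [H1 H2]; apply is_derive_Rpower, Hz; lra.
- intros z [H1 H2]. apply derivable_continuous_pt.
  exists (r * Rpower z (r - 1)). apply derivable_pt_lim_power, Hz, H1.
- exists z; auto.
Qed.

(** * The Emden-Fowler equation *)

Section EmdenFowler.

Variables p al a A : R.
Hypotheses (Hp : 1 < p) (Hal : 0 < al) (HA : 0 < A) (HAa : Rpower A (p - 1) = a).

(** On positive arguments the case [a = 1] is [f] itself, so [force] and [potential] serve both the
    transformed equation and the energy of the original one. *)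
Definition force (y : R) : R := y * (Rpower y (p - 1) - a).
Definition potential (y : R) : R := Rpower y (p + 1) / (p + 1) - a * y ^ 2 / 2.

(* [y t = s^th * u s] with [s = exp t], and [v = y']. *)
Definition ef_sol (y v : R -> R) : Prop := forall t,
  0 < y t /\ is_derive y t (v t) /\
  is_derive v t (- al * v t - force (y t) + exp (2 * t) * y t).

Definition ham (t y v : R) : R := v ^ 2 / 2 + potential y - exp (2 * t) * y ^ 2 / 2.

Lemma a_pos : 0 < a.
Proof. rewrite <- HAa; apply Rpower_pos. Qed.

Lemma is_derive_potential (y : R) : 0 < y -> is_derive potential y (force y).
Proof.
intros Hy. unfold potential, force.
pose proof (is_derive_Rpower (p + 1) y Hy) as H.
auto_derive; [eexists; exact H|].
replace (Derive (fun x => Rpower x (p + 1)) y) with ((p + 1) * (y * Rpower y (p - 1))).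
- field; lra.
- symmetry; etransitivity; [exact (is_derive_unique _ _ _ H)|].
  rewrite <- Rpower_S by exact Hy. f_equal; f_equal; ring.
Qed.

(** * Slopes of [force], in particular at the equilibrium [A] *)

Lemma is_derive_force (y : R) : 0 < y ->
  is_derive force y (p * Rpower y (p - 1) - a).
Proof.
intros Hy. unfold force.
pose proof (is_derive_Rpower (p - 1) y Hy) as H.
auto_derive; [eexists; exact H|].
replace (Derive (fun x => Rpower x (p - 1)) y) with ((p - 1) * Rpower y (p - 1 - 1)).
- replace (Rpower y (p - 1)) with (y * Rpower y (p - 1 - 1)); [ring|].
  rewrite <- Rpower_S by exact Hy. f_equal; ring.
- symmetry; apply (is_derive_unique _ _ _ H).
Qed.

Lemma force_MVT (x y : R) : 0 < x -> 0 < y ->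
  exists z, Rmin x y <= z <= Rmax x y /\
    force y - force x = (p * Rpower z (p - 1) - a) * (y - x).
Proof.
intros Hx Hy.
assert (Hz : forall z, Rmin x y <= z -> 0 < z).
{ intros z Hz. revert Hz; unfold Rmin; destruct Rle_dec; lra. }
destruct (MVT_gen force x y (fun z => p * Rpower z (p - 1) - a)) as [z Hz12].
- intros z [H1 H2]; apply is_derive_force, Hz; lra.
- intros z [H1 H2]. apply derivable_continuous_pt.
  exists (p * Rpower z (p - 1) - a). apply is_derive_Reals, is_derive_force, Hz, H1.
- exists z; auto.
Qed.

(** The mean value theorem is applied to [y^(p-1)], which equals [a] at [A], and not to [force]: the
    derivative [p * y^(p-1) - a] is negative for small [y], whereas the chord slope
    [y * (p-1) * z^(p-2)] stays positive on the whole box. *)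
Lemma force_slope (m M : R) : 0 < m -> m <= A <= M ->
  exists c L, 0 < c /\ 0 < L /\ forall y, m <= y <= M ->
    exists k, c <= k <= L /\ force y = k * (y - A).
Proof.
intros Hm HmM.
destruct (Rpower_bounds m M (p - 1 - 1) Hm) as [c [C [Hc [HC H]]]].
exists (m * ((p - 1) * c)), (M * ((p - 1) * C)).
split; [|split].
1,2: repeat apply Rmult_lt_0_compat; lra.
intros y Hy.
destruct (Rpower_sub_MVT (p - 1) A y) as [z [Hz Hz']]; [lra|lra|].
exists (y * ((p - 1) * Rpower z (p - 1 - 1))).
assert (Hz2 : c <= Rpower z (p - 1 - 1) <= C).
{ apply H. revert Hz; unfold Rmin, Rmax; destruct Rle_dec; lra. }
split.
- split; apply Rmult_le_compat; try lra.
  + apply Rmult_le_pos; lra.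
  + apply Rmult_le_compat_l; lra.
  + apply Rmult_le_pos; lra.
  + apply Rmult_le_compat_l; lra.
- unfold force. rewrite <- HAa, Hz'. ring.
Qed.

(** Subtracting the parabola of curvature [c] or [L] leaves a function that is monotone on each side
    of [A]. *)
Lemma potential_slope (c L m M : R) :
  0 < m -> m <= A <= M ->
  (forall y, m <= y <= M -> exists k, c <= k <= L /\ force y = k * (y - A)) ->
  forall y, m <= y <= M ->
    c / 2 * (y - A) ^ 2 <= potential y - potential A <= L / 2 * (y - A) ^ 2.
Proof.
intros Hm HmM Hk y Hy.
assert (HD : forall r x, 0 < x ->
  is_derive (fun x => potential x - r / 2 * (x - A) ^ 2) x (force x - r * (x - A))).
{ intros r x Hx. pose proof (is_derive_potential x Hx) as H.
  auto_derive; [eexists; exact H|]. subst_derive H. field. }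
destruct (Rle_lt_dec A y) as [HAy|HAy]; split.
- enough (potential A - c / 2 * (A - A) ^ 2 <= potential y - c / 2 * (y - A) ^ 2) by nra.
  apply (deriv_nonneg_le (fun x => potential x - c / 2 * (x - A) ^ 2)
    (fun x => force x - c * (x - A))); [lra| |].
  + intros x Hx; apply HD; lra.
  + intros x Hx. destruct (Hk x) as [k [Hk1 ->]]; [lra|]. nra.
- enough (potential y - L / 2 * (y - A) ^ 2 <= potential A - L / 2 * (A - A) ^ 2) by nra.
  apply (deriv_nonpos_le (fun x => potential x - L / 2 * (x - A) ^ 2)
    (fun x => force x - L * (x - A))); [lra| |].
  + intros x Hx; apply HD; lra.
  + intros x Hx. destruct (Hk x) as [k [Hk1 ->]]; [lra|]. nra.
- enough (potential A - c / 2 * (A - A) ^ 2 <= potential y - c / 2 * (y - A) ^ 2) by nra.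
  apply (deriv_nonpos_le (fun x => potential x - c / 2 * (x - A) ^ 2)
    (fun x => force x - c * (x - A))); [lra| |].
  + intros x Hx; apply HD; lra.
  + intros x Hx. destruct (Hk x) as [k [Hk1 ->]]; [lra|]. nra.
- enough (potential y - L / 2 * (y - A) ^ 2 <= potential A - L / 2 * (A - A) ^ 2) by nra.
  apply (deriv_nonneg_le (fun x => potential x - L / 2 * (x - A) ^ 2)
    (fun x => force x - L * (x - A))); [lra| |].
  + intros x Hx; apply HD; lra.
  + intros x Hx. destruct (Hk x) as [k [Hk1 ->]]; [lra|]. nra.
Qed.

(** The work of the forcing is cancelled by the time-dependent quadratic term, whose explicit time
    derivative has the good sign; [- al * v^2 - exp (2 * t) * y^2] remains. *)
Lemma ham_decreasing (y v : R -> R) (s t : R) : ef_sol y v -> s <= t ->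
  ham t (y t) (v t) <= ham s (y s) (v s).
Proof.
intros Hef Hst.
apply (deriv_nonpos_le (fun t => ham t (y t) (v t))
  (fun t => - al * v t ^ 2 - exp (2 * t) * y t ^ 2)); [exact Hst| |].
- intros x _. destruct (Hef x) as [Hy [Hdy Hdv]].
  pose proof (is_derive_potential (y x) Hy) as HG.
  unfold ham. auto_derive.
  + repeat split; eexists; eassumption.
  + subst_derive Hdy. subst_derive Hdv. subst_derive HG. field.
- intros x _. pose proof (exp_pos (2 * x)). pose proof (pow2_ge_0 (v x)).
  pose proof (pow2_ge_0 (y x)). nra.
Qed.

(** If [ham <= - d], the quadratic term, at most [E * y^2 / 2], must pay for [v^2 / 2], the power
    term and [d] together. Comparing it with each in turn bounds [v^2], bounds [y] above, and bounds
    [y] away from 0. [A] is put into [[m, M]] for the slope estimates. *)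
Lemma ham_box (b d : R) : 0 < d -> exists m M, 0 < m /\ m <= A <= M /\
  forall t y v, t <= b -> 0 < y -> ham t y v <= - d ->
    m <= y <= M /\ v ^ 2 <= M.
Proof.
intros Hd. pose proof a_pos as Ha.
set (E := a + exp (2 * b)).
assert (HE : 0 < E) by (unfold E; pose proof (exp_pos (2 * b)); lra).
set (Y := Rpower ((p + 1) / 2 * E) (/ (p - 1))).
assert (HY : 0 < Y) by apply Rpower_pos.
exists (Rmin A (sqrt (2 * d / E))), (Rmax A (Rmax Y (E * Y ^ 2))).
assert (Hs : 0 < sqrt (2 * d / E)).
{ apply sqrt_lt_R0, Rdiv_lt_0_compat; lra. }
split; [apply Rmin_glb_lt; auto|].
split; [split; [apply Rmin_l|apply Rmax_l]|].
intros t y v Ht Hy HH.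
assert (He : a + exp (2 * t) <= E).
{ unfold E. apply Rplus_le_compat_l. destruct (Req_dec t b) as [->|]; [lra|].
  left; apply exp_increasing; lra. }
pose proof (exp_pos (2 * t)) as He0.
assert (HP : 0 < Rpower y (p + 1) / (p + 1)).
{ apply Rdiv_lt_0_compat; [apply Rpower_pos|lra]. }
pose proof (pow2_ge_0 v) as Hv0.
assert (Hy2 : 0 < y ^ 2) by (apply pow_lt; auto).
assert (HH' : v ^ 2 / 2 + Rpower y (p + 1) / (p + 1) + d <= E * y ^ 2 / 2).
{ unfold ham, potential in HH. nra. }
assert (HyY : y <= Y).
{ assert (Rpower y (p - 1) <= (p + 1) / 2 * E).
  { replace (Rpower y (p + 1)) with (y ^ 2 * Rpower y (p - 1)) in HH', HP.
    2:{ replace (p + 1) with (p - 1 + 1 + 1) by ring.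
        rewrite !Rpower_S by exact Hy. ring. }
    assert (y ^ 2 * Rpower y (p - 1) / (p + 1) <= E * y ^ 2 / 2) by lra.
    apply (Rmult_le_reg_l (y ^ 2 / (p + 1))); [apply Rdiv_lt_0_compat; lra|].
    replace (y ^ 2 / (p + 1) * ((p + 1) / 2 * E)) with (E * y ^ 2 / 2) by (field; lra).
    unfold Rdiv in *; lra. }
  replace y with (Rpower (Rpower y (p - 1)) (/ (p - 1))).
  - apply Rle_Rpower_l; [left; apply Rinv_0_lt_compat; lra|].
    split; [apply Rpower_pos|auto].
  - rewrite Rpower_mult, Rinv_r, Rpower_1; lra. }
split; [split|].
- apply Rle_trans with (sqrt (2 * d / E)); [apply Rmin_r|].
  rewrite <- (sqrt_pow2 y) by lra. apply sqrt_le_1_alt.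
  apply Rle_div_l; lra.
- eapply Rle_trans; [exact HyY|]. eapply Rle_trans; [|apply Rmax_r]. apply Rmax_l.
- apply Rle_trans with (E * Y ^ 2).
  + assert (y ^ 2 <= Y ^ 2) by (apply pow_incr; lra). nra.
  + eapply Rle_trans; [|apply Rmax_r]. apply Rmax_r.
Qed.

(* Lyapunov functional: [v^2/2 + potential y - potential A + mu (y - A) v] with [mu] small. *)
Lemma approach (m M : R) : 0 < m -> m <= A <= M ->
  exists C c, 0 < C /\ 0 < c /\ forall y v s t, ef_sol y v -> s <= t ->
    (forall r, s <= r <= t -> m <= y r <= M /\ v r ^ 2 <= M) ->
    (y t - A) ^ 2 + v t ^ 2 <= C * (exp (- c * (t - s)) + exp (2 * t) ^ 2).
Proof.
intros Hm HmM.
destruct (force_slope m M Hm HmM) as [c1 [L [Hc1 [HL Hk]]]].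
pose proof (potential_slope c1 L m M Hm HmM Hk) as HG.
(* The first two bounds keep [mu * v^2] and the cross term [mu * al * (y - A) * v] below the damping
   and the restoring term; the last two give [mu^2 <= c1 / 4], hence coercivity of [V]. *)
set (mu := Rmin (Rmin (al / 4) (c1 / (2 * al))) (Rmin (1 / 2) (c1 / 2))).
assert (Hmu : 0 < mu /\ mu <= al / 4 /\ mu * (2 * al) <= c1 /\ mu <= 1 / 2 /\ mu <= c1 / 2).
{ assert (0 < c1 / (2 * al)) by (apply Rdiv_lt_0_compat; lra).
  assert (H1 : mu <= c1 / (2 * al)).
  { eapply Rle_trans; [apply Rmin_l|apply Rmin_r]. }
  repeat split.
  - repeat apply Rmin_glb_lt; lra.
  - eapply Rle_trans; [apply Rmin_l|apply Rmin_l].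
  - apply Rle_div_r in H1; lra.
  - eapply Rle_trans; [apply Rmin_r|apply Rmin_l].
  - eapply Rle_trans; [apply Rmin_r|apply Rmin_r]. }
clearbody mu. destruct Hmu as [Hmu0 [Hmu1 [Hmu2 [Hmu3 Hmu4]]]].
(* What remains of [al] and of [mu * c1] after the inequalities [I1], [I2], [I3] and [I6]; [C0]
   collects the forcing remainders of [I1] and [I2]. *)
set (ka := Rmin (3 * al / 8) (mu * c1 / 4)).
assert (Hka : 0 < ka) by (apply Rmin_glb_lt; [lra|apply Rdiv_lt_0_compat; [nra|lra]]).
assert (Hka1 : ka <= 3 * al / 8) by apply Rmin_l.
assert (Hka2 : ka <= mu * c1 / 4) by apply Rmin_r.
clearbody ka.
set (C0 := M ^ 2 * (2 / al + mu / c1)).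
assert (HC0 : 0 < C0).
{ assert (0 < 2 / al) by (apply Rdiv_lt_0_compat; lra).
  assert (0 < mu / c1) by (apply Rdiv_lt_0_compat; lra).
  apply Rmult_lt_0_compat; [apply pow_lt; lra|lra]. }
set (C2 := (1 + L + mu) / 2).
assert (HC2 : 0 < C2) by (unfold C2; lra).
set (k3 := Rmin 1 c1 / 4).
assert (Hk3 : 0 < k3 /\ k3 <= 1 / 4 /\ k3 <= c1 / 4).
{ unfold k3. pose proof (Rmin_l 1 c1). pose proof (Rmin_r 1 c1).
  assert (0 < Rmin 1 c1) by (apply Rmin_glb_lt; lra). lra. }
clearbody k3. destruct Hk3 as [Hk30 [Hk31 Hk32]].
set (c := ka / C2).
assert (Hc : 0 < c) by (apply Rdiv_lt_0_compat; auto).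
pose (V := fun w v P : R => v ^ 2 / 2 + P + mu * (w * v)).
assert (HVup : forall y v, m <= y <= M ->
  V (y - A) v (potential y - potential A) <= C2 * ((y - A) ^ 2 + v ^ 2)).
{ intros y v Hy. destruct (HG y Hy) as [_ HG2]. unfold V, C2.
  set (w := y - A) in *. pose proof (pow2_ge_0 (w - v)). pose proof (pow2_ge_0 w).
  pose proof (pow2_ge_0 v). nra. }
assert (HVlow : forall y v, m <= y <= M ->
  k3 * ((y - A) ^ 2 + v ^ 2) <= V (y - A) v (potential y - potential A)).
{ intros y v Hy. destruct (HG y Hy) as [HG1 _]. unfold V.
  set (w := y - A) in *. pose proof (pow2_ge_0 (v / 2 + mu * w)).
  assert (mu ^ 2 <= c1 / 4) by nra.
  pose proof (pow2_ge_0 w). pose proof (pow2_ge_0 v). nra. }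
set (S0 := (M ^ 2 + M)).
assert (HS0 : 0 < S0) by (unfold S0; nra).
exists ((C2 * S0 + C0 / c) / k3), c.
assert (HC0c : 0 < C0 / c) by (apply Rdiv_lt_0_compat; auto).
split; [apply Rdiv_lt_0_compat; nra|]. split; [exact Hc|].
intros y v s t Hef Hst Hbox.
pose proof (exp_pos (- c * (t - s))) as He1.
pose proof (exp_pos (2 * t)) as He2.
assert (HV : V (y t - A) (v t) (potential (y t) - potential A) <=
  V (y s - A) (v s) (potential (y s) - potential A) * exp (- c * (t - s))
   + (C0 * exp (2 * t) ^ 2) / c).
{ apply (gronwall_decay (fun t => V (y t - A) (v t) (potential (y t) - potential A))
   (fun t => v t * (- al * v t - force (y t) + exp (2 * t) * y t) + force (y t) * v t
     + mu * (v t * v t + (y t - A) * (- al * v t - force (y t) + exp (2 * t) * y t))));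
   auto.
  - assert (0 < exp (2 * t) ^ 2) by (apply pow_lt; auto). nra.
  - intros r _. destruct (Hef r) as [Hy [Hdy Hdv]].
    pose proof (is_derive_potential (y r) Hy) as HP.
    unfold V. auto_derive.
    + repeat split; eexists; eassumption.
    + subst_derive Hdy. subst_derive Hdv. subst_derive HP. field.
  - intros r Hr. destruct (Hbox r Hr) as [Hyr _].
    (* The forcing coefficient increases in time, so its value at the final time serves as a
       constant on the whole interval. *)
    apply Rle_trans with (- ka * ((y r - A) ^ 2 + v r ^ 2) + C0 * exp (2 * t) ^ 2).
    2:{ pose proof (HVup (y r) (v r) Hyr) as Hup.
        assert (c * V (y r - A) (v r) (potential (y r) - potential A) <=
          ka * ((y r - A) ^ 2 + v r ^ 2)); [|lra].
        replace (ka * ((y r - A) ^ 2 + v r ^ 2)) with (c * (C2 * ((y r - A) ^ 2 + v r ^ 2))).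
        - apply Rmult_le_compat_l; lra.
        - unfold c; field; lra. }
    destruct (Hk (y r) Hyr) as [k [Hk1 ->]].
    assert (Hexp : 0 < exp (2 * r) <= exp (2 * t)).
    { split; [apply exp_pos|]. destruct (Req_dec r t) as [->|]; [lra|].
      left; apply exp_increasing; lra. }
    revert Hexp. generalize (exp (2 * r)) (exp (2 * t)). intros e e' [He0 Hee'].
    set (w := y r - A) in *. set (x := v r). set (z := y r) in *.
    set (f := e * z).
    assert (Hf : 0 <= f <= e' * M).
    { unfold f; split; [apply Rmult_le_pos; lra|apply Rmult_le_compat; lra]. }
    assert (Hf2 : f ^ 2 <= e' ^ 2 * M ^ 2).
    { rewrite <- Rpow_mult_distr. apply pow_incr; exact Hf. }
    assert (HCf : f ^ 2 * (2 / al) + mu * (f ^ 2 / c1) <= C0 * e' ^ 2).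
    { unfold C0. assert (0 < 2 / al) by (apply Rdiv_lt_0_compat; lra).
      assert (0 < mu / c1) by (apply Rdiv_lt_0_compat; lra).
      replace (mu * (f ^ 2 / c1)) with (f ^ 2 * (mu / c1)) by (field; lra).
      nra. }
    assert (I1 : f * x <= al / 8 * x ^ 2 + f ^ 2 * (2 / al)).
    { apply Rminus_le_0.
      replace (al / 8 * x ^ 2 + f ^ 2 * (2 / al) - f * x)
        with (al / 8 * (x - 4 * f / al) ^ 2) by (field; lra).
      apply Rmult_le_pos; [lra|apply pow2_ge_0]. }
    assert (I2 : f * w <= c1 / 4 * w ^ 2 + f ^ 2 / c1).
    { apply Rminus_le_0.
      replace (c1 / 4 * w ^ 2 + f ^ 2 / c1 - f * w)
        with (c1 / 4 * (w - 2 * f / c1) ^ 2) by (field; lra).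
      apply Rmult_le_pos; [lra|apply pow2_ge_0]. }
    assert (I3 : - mu * al * (w * x) <= mu * (c1 / 2) * w ^ 2 + al / 4 * x ^ 2).
    { assert (- al * (w * x) <= c1 / 2 * w ^ 2 + al ^ 2 / (2 * c1) * x ^ 2).
      { apply Rminus_le_0.
        replace (c1 / 2 * w ^ 2 + al ^ 2 / (2 * c1) * x ^ 2 - - al * (w * x))
          with (c1 / 2 * (w + al * x / c1) ^ 2) by (field; lra).
        apply Rmult_le_pos; [lra|apply pow2_ge_0]. }
      assert (mu * (al ^ 2 / (2 * c1)) <= al / 4).
      { replace (mu * (al ^ 2 / (2 * c1))) with ((mu * (2 * al)) * al / 4 / c1) by (field; lra).
        apply Rle_div_l; [lra|]. nra. }
      pose proof (pow2_ge_0 x). nra. }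
    pose proof (pow2_ge_0 x). pose proof (pow2_ge_0 w).
    assert (I4 : mu * (f * w) <= mu * (c1 / 4 * w ^ 2 + f ^ 2 / c1)) by (apply Rmult_le_compat_l; lra).
    assert (I5 : mu * (c1 * w ^ 2) <= mu * (k * w ^ 2)).
    { apply Rmult_le_compat_l; [lra|]. apply Rmult_le_compat_r; lra. }
    assert (I6 : mu * x ^ 2 <= al / 4 * x ^ 2) by (apply Rmult_le_compat_r; lra).
    assert (I7 : ka * x ^ 2 <= 3 * al / 8 * x ^ 2) by (apply Rmult_le_compat_r; lra).
    assert (I8 : ka * w ^ 2 <= mu * c1 / 4 * w ^ 2) by (apply Rmult_le_compat_r; lra).
    lra. }
destruct (Hbox t) as [Hyt _]; [lra|].
destruct (Hbox s) as [Hys Hvs]; [lra|].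
pose proof (HVlow (y t) (v t) Hyt) as HL1.
pose proof (HVup (y s) (v s) Hys) as HU1.
assert (HSs : (y s - A) ^ 2 + v s ^ 2 <= S0) by (unfold S0; nra).
apply (Rmult_le_reg_l k3); [exact Hk30|].
replace (k3 * ((C2 * S0 + C0 / c) / k3 * (exp (- c * (t - s)) + exp (2 * t) ^ 2)))
  with ((C2 * S0 + C0 / c) * (exp (- c * (t - s)) + exp (2 * t) ^ 2)) by (field; split; lra).
assert (HV3 : V (y s - A) (v s) (potential (y s) - potential A) <= C2 * S0) by nra.
replace (C0 * exp (2 * t) ^ 2 / c) with (C0 / c * exp (2 * t) ^ 2) in HV by (field; lra).
assert (0 < exp (2 * t) ^ 2) by (apply pow_lt; auto).
assert (0 < C2 * S0) by nra.
nra.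
Qed.

(* Lyapunov functional for the difference [z] of two solutions: [z'^2/2 + K z^2/2 + mu z z']
   with [K = (p-1) a] the derivative of [force] at [A]. *)
Lemma contraction : exists rho C c, 0 < rho /\ 0 < C /\ 0 < c /\
  exists T0, forall y1 v1 y2 v2 s t, ef_sol y1 v1 -> ef_sol y2 v2 -> s <= t <= T0 ->
    (forall r, s <= r <= t -> Rabs (y1 r - A) <= rho /\ Rabs (y2 r - A) <= rho) ->
    (y1 t - y2 t) ^ 2 + (v1 t - v2 t) ^ 2 <=
      C * ((y1 s - y2 s) ^ 2 + (v1 s - v2 s) ^ 2) * exp (- c * (t - s)).
Proof.
pose proof a_pos as Ha.
set (K := (p - 1) * a).
assert (HK : 0 < K) by (unfold K; nra).
set (mu := Rmin (Rmin (al / 4) (K / (4 * al))) (Rmin (1 / 2) (K / 2))).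
assert (Hmu : 0 < mu /\ mu <= al / 4 /\ mu * (4 * al) <= K /\ mu <= 1 / 2 /\ mu <= K / 2).
{ assert (0 < K / (4 * al)) by (apply Rdiv_lt_0_compat; lra).
  assert (H1 : mu <= K / (4 * al)).
  { eapply Rle_trans; [apply Rmin_l|apply Rmin_r]. }
  repeat split.
  - repeat apply Rmin_glb_lt; lra.
  - eapply Rle_trans; [apply Rmin_l|apply Rmin_l].
  - apply Rle_div_r in H1; lra.
  - eapply Rle_trans; [apply Rmin_r|apply Rmin_l].
  - eapply Rle_trans; [apply Rmin_r|apply Rmin_r]. }
clearbody mu. destruct Hmu as [Hmu0 [Hmu1 [Hmu2 [Hmu3 Hmu4]]]].
set (ka := Rmin (al / 2) (mu * K / 4)).
assert (Hka : 0 < ka) by (apply Rmin_glb_lt; [lra|apply Rdiv_lt_0_compat; [nra|lra]]).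
assert (Hka1 : ka <= al / 2) by apply Rmin_l.
assert (Hka2 : ka <= mu * K / 4) by apply Rmin_r.
clearbody ka.
(* Error budget for the effective slope [k']: half of [eta] goes to the nonlinearity, through [rho],
   and half to [exp (2 * t)], through [T0]. [eta <= K / 2] keeps [k' >= K / 2]; [eta <= ka] lets the
   term [(K - k') * (w * x)] cost at most half of the rate, which leaves [ka / 2]. *)
set (eta := Rmin ka (K / 2)).
assert (Heta : 0 < eta /\ eta <= ka /\ eta <= K / 2).
{ unfold eta. split; [apply Rmin_glb_lt; lra|split; [apply Rmin_l|apply Rmin_r]]. }
clearbody eta. destruct Heta as [Heta0 [Heta1 Heta2]].
assert (Hrho : exists rho, 0 < rho < A /\ forall z, Rabs (z - A) <= rho ->
  Rabs (p * Rpower z (p - 1) - a - K) <= eta / 2).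
{ pose proof (is_derive_Rpower (p - 1) A HA) as HD.
  assert (Hcont : continuity_pt (fun z => Rpower z (p - 1)) A).
  { apply derivable_continuous_pt. eexists. apply is_derive_Reals, HD. }
  destruct (Hcont (eta / (2 * p))) as [del [Hdel Hz]]; [apply Rdiv_lt_0_compat; lra|].
  exists (Rmin (del / 2) (A / 2)). split.
  { split; [apply Rmin_glb_lt; lra|]. eapply Rle_lt_trans; [apply Rmin_r|lra]. }
  intros z Hzr.
  replace (p * Rpower z (p - 1) - a - K) with (p * (Rpower z (p - 1) - Rpower A (p - 1)))
    by (rewrite HAa; unfold K; ring).
  rewrite Rabs_mult, (Rabs_pos_eq p) by lra.
  destruct (Req_dec z A) as [->|Hne].
  { rewrite Rminus_diag, Rabs_R0. lra. }
  assert (HH : Rabs (Rpower z (p - 1) - Rpower A (p - 1)) < eta / (2 * p)).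
  { apply (Hz z). split; [split; [exact I|auto]|].
    simpl. unfold Rdist. eapply Rle_lt_trans; [exact Hzr|].
    eapply Rle_lt_trans; [apply Rmin_l|lra]. }
  replace (eta / 2) with (p * (eta / (2 * p))) by (field; lra).
  apply Rmult_le_compat_l; lra. }
destruct Hrho as [rho [[Hrho0 HrhoA] Hrho]].
set (C2 := (1 + K + mu) / 2).
assert (HC2 : 0 < C2) by (unfold C2; lra).
set (k3 := Rmin 1 K / 4).
assert (Hk3 : 0 < k3 /\ k3 <= 1 / 4 /\ k3 <= K / 4).
{ unfold k3. pose proof (Rmin_l 1 K). pose proof (Rmin_r 1 K).
  assert (0 < Rmin 1 K) by (apply Rmin_glb_lt; lra). lra. }
clearbody k3. destruct Hk3 as [Hk30 [Hk31 Hk32]].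
set (c := ka / 2 / C2).
assert (Hc : 0 < c) by (apply Rdiv_lt_0_compat; lra).
pose (V := fun w v : R => v ^ 2 / 2 + K * w ^ 2 / 2 + mu * (w * v)).
assert (HVup : forall w v, V w v <= C2 * (w ^ 2 + v ^ 2)).
{ intros w v. unfold V, C2. pose proof (pow2_ge_0 (w - v)). pose proof (pow2_ge_0 w).
  pose proof (pow2_ge_0 v). nra. }
assert (HVlow : forall w v, k3 * (w ^ 2 + v ^ 2) <= V w v).
{ intros w v. unfold V. pose proof (pow2_ge_0 (v / 2 + mu * w)).
  assert (mu ^ 2 <= K / 4) by nra.
  pose proof (pow2_ge_0 w). pose proof (pow2_ge_0 v). nra. }
exists rho, (C2 / k3), c.
split; [exact Hrho0|]. split; [apply Rdiv_lt_0_compat; auto|]. split; [exact Hc|].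
exists (ln (eta / 2) / 2).
intros y1 v1 y2 v2 s t Hef1 Hef2 [Hst HtT] Hbox.
assert (HV : V (y1 t - y2 t) (v1 t - v2 t) <=
  V (y1 s - y2 s) (v1 s - v2 s) * exp (- c * (t - s))).
{ apply (gronwall_le (fun t => V (y1 t - y2 t) (v1 t - v2 t))
   (fun t =>
     let w := y1 t - y2 t in let x := v1 t - v2 t in
     let x' := - al * x - (force (y1 t) - force (y2 t)) + exp (2 * t) * w in
     x * x' + K * w * x + mu * (x * x + w * x'))); auto.
  - intros r _. destruct (Hef1 r) as [_ [Hdy1 Hdv1]]. destruct (Hef2 r) as [_ [Hdy2 Hdv2]].
    unfold V. auto_derive.
    + repeat split; eexists; eassumption.
    + subst_derive Hdy1. subst_derive Hdv1. subst_derive Hdy2. subst_derive Hdv2. field.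
  - intros r Hr. cbv zeta. destruct (Hbox r Hr) as [Hy1 Hy2].
    assert (Hk : exists k, Rabs (k - K) <= eta / 2 /\
      force (y1 r) - force (y2 r) = k * (y1 r - y2 r)).
    { apply Rabs_le_between in Hy1. apply Rabs_le_between in Hy2.
      destruct (force_MVT (y2 r) (y1 r)) as [z [Hz1 Hz2]]; [lra|lra|].
      exists (p * Rpower z (p - 1) - a); split; [|exact Hz2].
      apply Hrho. apply Rabs_le_between. revert Hz1.
      unfold Rmin, Rmax; destruct Rle_dec; lra. }
    destruct Hk as [k [Hk ->]].
    assert (Hexp : 0 < exp (2 * r) <= eta / 2).
    { split; [apply exp_pos|]. rewrite <- (exp_ln (eta / 2)) by lra.
      destruct (Req_dec (2 * r) (ln (eta / 2))) as [->|]; [lra|].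
      left; apply exp_increasing; lra. }
    apply Rle_trans with (- (ka / 2) * ((y1 r - y2 r) ^ 2 + (v1 r - v2 r) ^ 2)).
    2:{ pose proof (HVup (y1 r - y2 r) (v1 r - v2 r)) as Hup.
        replace (ka / 2) with (c * C2) by (unfold c; field; lra). nra. }
    revert Hexp. generalize (exp (2 * r)). intros e [He0 He].
    set (w := y1 r - y2 r). set (x := v1 r - v2 r).
    apply Rabs_le_between in Hk.
    pose (k' := k - e).
    assert (Hk' : - eta <= k' - K <= eta) by (unfold k'; lra).
    replace (- al * x - k * w + e * w) with (- al * x - k' * w) by (unfold k'; ring).
    pose proof (pow2_ge_0 x). pose proof (pow2_ge_0 w).
    assert (I1 : (K - k') * (w * x) <= eta / 2 * (w ^ 2 + x ^ 2)).
    { assert (2 * Rabs (w * x) <= w ^ 2 + x ^ 2).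
      { rewrite Rabs_mult. rewrite <- (pow2_abs w), <- (pow2_abs x).
        pose proof (pow2_ge_0 (Rabs w - Rabs x)). nra. }
      apply Rle_trans with (eta * Rabs (w * x)); [|nra].
      apply Rle_trans with (Rabs (K - k') * Rabs (w * x)).
      - rewrite <- Rabs_mult. apply Rle_abs.
      - apply Rmult_le_compat_r; [apply Rabs_pos|]. apply Rabs_le_between; lra. }
    assert (I3 : - mu * al * (w * x) <= mu * (K / 4) * w ^ 2 + al / 4 * x ^ 2).
    { assert (- al * (w * x) <= K / 4 * w ^ 2 + al ^ 2 / K * x ^ 2).
      { apply Rminus_le_0.
        replace (K / 4 * w ^ 2 + al ^ 2 / K * x ^ 2 - - al * (w * x))
          with (K / 4 * (w + 2 * al * x / K) ^ 2) by (field; lra).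
        apply Rmult_le_pos; [lra|apply pow2_ge_0]. }
      assert (mu * (al ^ 2 / K) <= al / 4).
      { replace (mu * (al ^ 2 / K)) with ((mu * (4 * al)) * al / 4 / K) by (field; lra).
        apply Rle_div_l; [lra|]. nra. }
      nra. }
    assert (I5 : mu * (K / 2 * w ^ 2) <= mu * (k' * w ^ 2)).
    { apply Rmult_le_compat_l; [lra|]. apply Rmult_le_compat_r; lra. }
    assert (I6 : mu * x ^ 2 <= al / 4 * x ^ 2) by (apply Rmult_le_compat_r; lra).
    assert (I7 : ka * x ^ 2 <= al / 2 * x ^ 2) by (apply Rmult_le_compat_r; lra).
    assert (I8 : ka * w ^ 2 <= mu * K / 4 * w ^ 2) by (apply Rmult_le_compat_r; lra).
    assert (I9 : eta * (w ^ 2 + x ^ 2) <= ka * (w ^ 2 + x ^ 2))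
      by (apply Rmult_le_compat_r; lra).
    lra. }
pose proof (HVlow (y1 t - y2 t) (v1 t - v2 t)) as HL1.
pose proof (HVup (y1 s - y2 s) (v1 s - v2 s)) as HU1.
apply (Rmult_le_reg_l k3); [exact Hk30|].
eapply Rle_trans; [exact HL1|]. eapply Rle_trans; [exact HV|].
replace (k3 * (C2 / k3 * ((y1 s - y2 s) ^ 2 + (v1 s - v2 s) ^ 2) * exp (- c * (t - s))))
  with ((C2 * ((y1 s - y2 s) ^ 2 + (v1 s - v2 s) ^ 2)) * exp (- c * (t - s)))
  by (field; lra).
apply Rmult_le_compat_r; [left; apply exp_pos|exact HU1].
Qed.

(** Plain Gronwall: [force] is Lipschitz on a box and the damping only helps. This carries closeness
    past the time limit [T0] of [contraction]. *)
Lemma continuous_dependence (m M s b : R) : 0 < m -> s <= b ->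
  exists C, 0 < C /\ forall y1 v1 y2 v2, ef_sol y1 v1 -> ef_sol y2 v2 ->
    (forall r, s <= r <= b -> m <= y1 r <= M /\ m <= y2 r <= M) ->
    forall t, s <= t <= b ->
    (y1 t - y2 t) ^ 2 + (v1 t - v2 t) ^ 2 <=
      C * ((y1 s - y2 s) ^ 2 + (v1 s - v2 s) ^ 2).
Proof.
intros Hm Hsb. pose proof a_pos as Ha.
destruct (Rpower_bounds m M (p - 1) Hm) as [c [C [_ [HC HR]]]].
set (L := p * C + a + exp (2 * b)).
pose proof (exp_pos (2 * b)) as Hb.
assert (HL : 0 < L) by (unfold L; nra).
exists (exp ((1 + L) * (b - s))). split; [apply exp_pos|].
intros y1 v1 y2 v2 Hef1 Hef2 Hbox t Ht.
pose (V := fun t => (y1 t - y2 t) ^ 2 + (v1 t - v2 t) ^ 2).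
assert (HV : V t <= V s * exp ((1 + L) * (t - s))).
{ apply (gronwall_le V
   (fun t =>
     let w := y1 t - y2 t in let x := v1 t - v2 t in
     let x' := - al * x - (force (y1 t) - force (y2 t)) + exp (2 * t) * w in
     2 * (w * x) + 2 * (x * x'))); [lra| |].
  - intros r _. destruct (Hef1 r) as [_ [Hdy1 Hdv1]]. destruct (Hef2 r) as [_ [Hdy2 Hdv2]].
    unfold V. auto_derive.
    + repeat split; eexists; eassumption.
    + subst_derive Hdy1. subst_derive Hdv1. subst_derive Hdy2. subst_derive Hdv2. ring.
  - intros r Hr. cbv zeta. destruct (Hbox r) as [Hy1 Hy2]; [lra|].
    destruct (force_MVT (y2 r) (y1 r)) as [z [Hz1 Hz2]]; [lra|lra|].
    rewrite Hz2.
    assert (Hz : 0 < Rpower z (p - 1) <= C).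
    { split; [apply Rpower_pos|]. apply HR.
      revert Hz1; unfold Rmin, Rmax; destruct Rle_dec; lra. }
    assert (Hexp : 0 < exp (2 * r) <= exp (2 * b)).
    { split; [apply exp_pos|]. destruct (Req_dec r b) as [->|]; [lra|].
      left; apply exp_increasing; lra. }
    unfold V. set (w := y1 r - y2 r). set (x := v1 r - v2 r).
    set (k := - (p * Rpower z (p - 1) - a) + exp (2 * r)).
    assert (Hk : Rabs k <= L) by (apply Rabs_le_between; unfold k, L; nra).
    assert (Hwx : 2 * Rabs (w * x) <= w ^ 2 + x ^ 2).
    { rewrite Rabs_mult. rewrite <- (pow2_abs w), <- (pow2_abs x).
      pose proof (pow2_ge_0 (Rabs w - Rabs x)). nra. }
    assert (H1 : (1 + k) * (w * x) <= (1 + L) * Rabs (w * x)).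
    { eapply Rle_trans; [apply Rle_abs|]. rewrite Rabs_mult.
      apply Rmult_le_compat_r; [apply Rabs_pos|].
      eapply Rle_trans; [apply Rabs_triang|]. rewrite Rabs_R1. lra. }
    replace (2 * (w * x) + 2 * (x * (- al * x - (p * Rpower z (p - 1) - a) * w + exp (2 * r) * w)))
      with (2 * ((1 + k) * (w * x)) - 2 * al * x ^ 2) by (unfold k; ring).
    pose proof (pow2_ge_0 x). nra. }
eapply Rle_trans; [exact HV|]. rewrite (Rmult_comm (exp _)).
apply Rmult_le_compat_l.
- unfold V. pose proof (pow2_ge_0 (y1 s - y2 s)). pose proof (pow2_ge_0 (v1 s - v2 s)). lra.
- destruct (Req_dec t b) as [->|]; [lra|]. left; apply exp_increasing. nra.
Qed.

(** * From exponential contraction to a locally uniform limit *)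

Lemma exp_small (c eps : R) : 0 < c -> 0 < eps ->
  exists T, forall t, T <= t -> exp (- c * t) <= eps.
Proof.
intros Hc He. exists (- ln eps / c). intros t Ht.
rewrite <- (exp_ln eps) by exact He.
apply Rle_div_l in Ht; [|exact Hc].
destruct (Req_dec (- c * t) (ln eps)) as [->|]; [lra|].
left; apply exp_increasing; nra.
Qed.

(** The times are chosen backwards: [s'] where the forcing is weak, [s0] at least a contraction
    length [L2] earlier, and [tau g] at least an approach length [L] before [s0]. *)
Lemma family_cauchy (Y V : R -> R -> R) (d g0 : R) (tau : R -> R) :
  0 < d ->
  (forall g, g0 < g -> ef_sol (Y g) (V g)) ->
  (forall g t, g0 < g -> tau g <= t -> ham t (Y g t) (V g t) <= - d) ->
  (forall t, exists G, forall g, G < g -> tau g <= t) ->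
  forall s b eps, s <= b -> 0 < eps -> exists G, forall g1 g2, G < g1 -> G < g2 ->
    forall t, s <= t <= b -> (Y g1 t - Y g2 t) ^ 2 + (V g1 t - V g2 t) ^ 2 <= eps.
Proof.
intros Hd Hef Hham Htau s b eps Hsb Heps.
destruct (ham_box b d Hd) as [m [M [Hm [HmM Hbox]]]].
destruct contraction as [rho [C1 [c1 [Hrho [HC1 [Hc1 [T0 Hcon]]]]]]].
destruct (approach m M Hm HmM) as [C2 [c2 [HC2 [Hc2 Happ]]]].
(* Half of [rho^2] is allotted to the forcing, by [T1], and half to the transient, by [L]. *)
assert (HT1 : exists T1, forall t, t <= T1 -> C2 * (exp (2 * t) ^ 2) <= rho ^ 2 / 2).
{ destruct (exp_small 4 (rho ^ 2 / (2 * C2))) as [T HT]; [lra| |].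
  { apply Rdiv_lt_0_compat; [apply pow_lt; auto|lra]. }
  exists (- T). intros t Ht. replace (exp (2 * t) ^ 2) with (exp (- 4 * (- t))).
  - replace (rho ^ 2 / 2) with (C2 * (rho ^ 2 / (2 * C2))) by (field; lra).
    apply Rmult_le_compat_l; [lra|]. apply HT; lra.
  - simpl. rewrite Rmult_1_r, <- exp_plus. f_equal; ring. }
destruct HT1 as [T1 HT1].
destruct (exp_small c2 (rho ^ 2 / (2 * C2))) as [L HL]; [lra| |].
{ apply Rdiv_lt_0_compat; [apply pow_lt; auto|lra]. }
set (s' := Rmin s (Rmin T0 T1)).
assert (Hs' : s' <= s /\ s' <= T0 /\ s' <= T1).
{ unfold s'. repeat split; [apply Rmin_l| |]; (eapply Rle_trans; [apply Rmin_r|]).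
  - apply Rmin_l. - apply Rmin_r. }
clearbody s'. destruct Hs' as [Hs1 [Hs2 Hs3]].
destruct (continuous_dependence m M s' b Hm) as [C3 [HC3 Hdep]]; [lra|].
(* The box bounds the squared distance at [s0] by [4 * M^2 + 4 * M]; [L2] is a time that brings this
   below [eps] after the losses [C1] and [C3]. *)
destruct (exp_small c1 (eps / (C3 * C1 * (4 * M ^ 2 + 4 * M)))) as [L2 HL2]; [lra| |].
{ apply Rdiv_lt_0_compat; [lra|]. repeat apply Rmult_lt_0_compat; nra. }
set (s0 := s' - Rmax L2 0).
assert (Hs0 : s0 <= s') by (unfold s0; pose proof (Rmax_r L2 0); lra).
assert (Hs0' : L2 <= s' - s0) by (unfold s0; pose proof (Rmax_l L2 0); lra).
destruct (Htau (s0 - Rmax L 0)) as [G HG].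
exists (Rmax g0 G).
assert (Hall : forall g, Rmax g0 G < g -> ef_sol (Y g) (V g) /\
  (forall t, s0 <= t <= b -> m <= Y g t <= M /\ V g t ^ 2 <= M) /\
  (forall t, s0 <= t <= s' -> Rabs (Y g t - A) <= rho)).
{ intros g Hg. pose proof (Rmax_l g0 G). pose proof (Rmax_r g0 G).
  pose proof (Rmax_l L 0). pose proof (Rmax_r L 0).
  assert (Hg0 : g0 < g) by lra.
  assert (Htg : tau g <= s0 - Rmax L 0) by (apply HG; lra).
  assert (Hb : forall t, tau g <= t <= b -> m <= Y g t <= M /\ V g t ^ 2 <= M).
  { intros t Ht. apply (Hbox t); [lra|apply (Hef g Hg0)|apply Hham; lra]. }
  split; [auto|]. split; [intros t Ht; apply Hb; lra|].
  intros t Ht.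
  assert (E1 : (Y g t - A) ^ 2 + V g t ^ 2 <=
    C2 * (exp (- c2 * (t - tau g)) + exp (2 * t) ^ 2)).
  { apply (Happ (Y g)); [auto|lra|]. intros r Hr; apply Hb; lra. }
  assert (E2 : C2 * exp (- c2 * (t - tau g)) <= rho ^ 2 / 2).
  { replace (rho ^ 2 / 2) with (C2 * (rho ^ 2 / (2 * C2))) by (field; lra).
    apply Rmult_le_compat_l; [lra|]. apply HL; lra. }
  assert (E3 : C2 * exp (2 * t) ^ 2 <= rho ^ 2 / 2) by (apply HT1; lra).
  pose proof (pow2_ge_0 (V g t)).
  rewrite <- (Rabs_pos_eq rho) by lra. apply Rsqr_le_abs_0. unfold Rsqr; lra. }
intros g1 g2 Hg1 Hg2 t Ht.
destruct (Hall g1 Hg1) as [Hef1 [Hb1 HA1]]. destruct (Hall g2 Hg2) as [Hef2 [Hb2 HA2]].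
pose proof (Hcon (Y g1) (V g1) (Y g2) (V g2) s0 s' Hef1 Hef2) as Hc.
specialize (Hc (conj Hs0 Hs2)).
assert (Hc' := Hc (fun r Hr => conj (HA1 r Hr) (HA2 r Hr))). clear Hc.
pose proof (Hdep (Y g1) (V g1) (Y g2) (V g2) Hef1 Hef2) as Hd'.
assert (Hd'' := Hd' (fun r Hr => conj (proj1 (Hb1 r ltac:(lra))) (proj1 (Hb2 r ltac:(lra))))
  t ltac:(lra)). clear Hd'.
assert (HS : (Y g1 s0 - Y g2 s0) ^ 2 + (V g1 s0 - V g2 s0) ^ 2 <= 4 * M ^ 2 + 4 * M).
{ destruct (Hb1 s0) as [Hy1 Hv1]; [lra|]. destruct (Hb2 s0) as [Hy2 Hv2]; [lra|].
  pose proof (pow2_ge_0 (V g1 s0 + V g2 s0)).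
  assert ((Y g1 s0 - Y g2 s0) ^ 2 <= M ^ 2) by (rewrite <- pow2_abs; apply pow_incr;
    split; [apply Rabs_pos|apply Rabs_le_between; lra]).
  pose proof (pow2_ge_0 M). nra. }
pose proof (HL2 (s' - s0) Hs0') as He.
pose proof (exp_pos (- c1 * (s' - s0))) as Hepos.
assert (HM : 0 < 4 * M ^ 2 + 4 * M) by nra.
eapply Rle_trans; [exact Hd''|].
apply Rle_trans with (C3 * (C1 * (4 * M ^ 2 + 4 * M) *
  (eps / (C3 * C1 * (4 * M ^ 2 + 4 * M))))).
2:{ right; field. repeat split; lra. }
apply Rmult_le_compat_l; [lra|]. eapply Rle_trans; [exact Hc'|].
apply Rmult_le_compat; [|lra| |exact He].
- apply Rmult_le_pos; [lra|].
  pose proof (pow2_ge_0 (Y g1 s0 - Y g2 s0)). pose proof (pow2_ge_0 (V g1 s0 - V g2 s0)). lra.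
- apply Rmult_le_compat_l; lra.
Qed.

Lemma force_lipschitz (m M : R) : 0 < m ->
  exists L, 0 < L /\ forall x y, m <= x <= M -> m <= y <= M ->
    Rabs (force y - force x) <= L * Rabs (y - x).
Proof.
intros Hm. pose proof a_pos as Ha.
destruct (Rpower_bounds m M (p - 1) Hm) as [c [C [_ [HC HR]]]].
exists (p * C + a). split; [nra|]. intros x y Hx Hy.
destruct (force_MVT x y) as [z [Hz ->]]; [lra|lra|].
rewrite Rabs_mult. apply Rmult_le_compat_r; [apply Rabs_pos|].
assert (0 < Rpower z (p - 1) <= C).
{ split; [apply Rpower_pos|]. apply HR.
  revert Hz; unfold Rmin, Rmax; destruct Rle_dec; lra. }
apply Rabs_le_between; nra.
Qed.

Lemma INR_above (x : R) : exists n, forall k, (n <= k)%nat -> x < INR k.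
Proof.
destruct (INR_unbounded x) as [n Hn]. exists n. intros k Hk.
apply le_INR in Hk. lra.
Qed.

(** The limit is defined along integer parameters; fixing one parameter in the Cauchy bound and
    sending the other along the integers gives the estimate for all real parameters. *)
Lemma locally_uniform_limit (F : R -> R -> R) :
  (forall s b eps, s <= b -> 0 < eps -> exists G, forall g1 g2, G < g1 -> G < g2 ->
    forall t, s <= t <= b -> Rabs (F g1 t - F g2 t) <= eps) ->
  exists f, forall s b eps, s <= b -> 0 < eps -> exists G, forall g, G < g ->
    forall t, s <= t <= b -> Rabs (F g t - f t) <= eps.
Proof.
intros HF.
destruct (choice (fun t (l : R) => is_lim_seq (fun n => F (INR n) t) l)) as [f Hf].
{ intros t. destruct (Rcomplete.R_complete (fun n => F (INR n) t)) as [l Hl].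
  - intros eps Heps. destruct (HF t t (eps / 2)) as [G HG]; [lra|lra|].
    destruct (INR_above G) as [N HN]. exists N. intros n k Hn Hk.
    apply Rle_lt_trans with (eps / 2); [|lra]. apply HG; [apply HN, Hn|apply HN, Hk|lra].
  - exists l. apply is_lim_seq_Reals, Hl. }
exists f. intros s b eps Hsb Heps. destruct (HF s b eps Hsb Heps) as [G HG].
exists G. intros g Hg t Ht.
assert (HL : is_lim_seq (fun n => Rabs (F g t - F (INR n) t)) (Rabs (F g t - f t))).
{ apply (is_lim_seq_abs _ (F g t - f t)).
  apply is_lim_seq_minus'; [apply is_lim_seq_const|apply Hf]. }
apply (is_lim_seq_le_loc _ _ (Rabs (F g t - f t)) eps) with (2 := HL) (3 := is_lim_seq_const eps).
destruct (INR_above G) as [N HN]. exists N. intros n Hn.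
apply HG; [exact Hg|apply HN, Hn|exact Ht].
Qed.

(** Uniform convergence of derivatives is used twice: for [y' = v], and for the equation, where
    convergence of the right-hand side rests on the Lipschitz bound for [force] on a box. *)
Lemma family_limit (Y V : R -> R -> R) (d g0 : R) (tau : R -> R) :
  0 < d ->
  (forall g, g0 < g -> ef_sol (Y g) (V g)) ->
  (forall g t, g0 < g -> tau g <= t -> ham t (Y g t) (V g t) <= - d) ->
  (forall t, exists G, forall g, G < g -> tau g <= t) ->
  exists y v, ef_sol y v /\ (forall t, ham t (y t) (v t) <= - d) /\
    forall s b eps, s <= b -> 0 < eps -> exists G, forall g, G < g ->
      forall t, s <= t <= b -> Rabs (Y g t - y t) <= eps.
Proof.
intros Hd Hef Hham Htau.
assert (HCau : forall s b eps, s <= b -> 0 < eps -> exists G, forall g1 g2, G < g1 -> G < g2 ->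
    forall t, s <= t <= b -> Rabs (Y g1 t - Y g2 t) <= eps /\ Rabs (V g1 t - V g2 t) <= eps).
{ intros s b eps Hsb Heps.
  destruct (family_cauchy Y V d g0 tau Hd Hef Hham Htau s b (eps ^ 2) Hsb) as [G HG].
  { apply pow_lt, Heps. }
  exists G. intros g1 g2 Hg1 Hg2 t Ht. specialize (HG g1 g2 Hg1 Hg2 t Ht).
  pose proof (pow2_ge_0 (Y g1 t - Y g2 t)). pose proof (pow2_ge_0 (V g1 t - V g2 t)).
  rewrite <- (Rabs_pos_eq eps) by lra.
  split; apply Rsqr_le_abs_0; unfold Rsqr; lra. }
destruct (locally_uniform_limit Y) as [y Hy].
{ intros s b eps Hsb Heps. destruct (HCau s b eps Hsb Heps) as [G HG]. exists G.
  intros g1 g2 Hg1 Hg2 t Ht. apply HG; auto. }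
destruct (locally_uniform_limit V) as [v Hv].
{ intros s b eps Hsb Heps. destruct (HCau s b eps Hsb Heps) as [G HG]. exists G.
  intros g1 g2 Hg1 Hg2 t Ht. apply HG; auto. }
pose (gam := fun n : nat => Rmax g0 0 + 1 + INR n).
assert (Hgam : forall n, g0 < gam n).
{ intros n. unfold gam. pose proof (Rmax_l g0 0). pose proof (pos_INR n). lra. }
assert (Hgam2 : forall x, exists N, forall n, (N <= n)%nat -> x < gam n).
{ intros x. destruct (INR_above x) as [N HN]. exists N. intros n Hn.
  specialize (HN n Hn). unfold gam. pose proof (Rmax_r g0 0). lra. }
assert (Hlim : forall F f, (forall s b eps, s <= b -> 0 < eps -> exists G, forall g, G < g ->
      forall t, s <= t <= b -> Rabs (F g t - f t) <= eps) ->
    (forall t, is_lim_seq (fun n => F (gam n) t) (f t)) /\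
    (forall c, CVU (fun n => F (gam n)) f c (mkposreal 1 Rlt_0_1))).
{ intros F f HF. split.
  - intros t. apply is_lim_seq_Reals. intros eps Heps.
    destruct (HF t t (eps / 2)) as [G HG]; [lra|lra|].
    destruct (Hgam2 G) as [N HN]. exists N. intros n Hn. unfold Rdist.
    apply Rle_lt_trans with (eps / 2); [|lra]. apply HG; [apply HN, Hn|lra].
  - intros c eps Heps. destruct (HF (c - 1) (c + 1) (eps / 2)) as [G HG]; [lra|lra|].
    destruct (Hgam2 G) as [N HN]. exists N. intros n t Hn Ht.
    unfold Boule in Ht; simpl in Ht. apply Rabs_def2 in Ht.
    rewrite Rabs_minus_sym.
    apply Rle_lt_trans with (eps / 2); [|lra]. apply HG; [apply HN, Hn|lra]. }
destruct (Hlim Y y Hy) as [Hyl Hyu]. destruct (Hlim V v Hv) as [Hvl Hvu].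
(* A limit of positive functions could vanish; the uniform lower bound [m] keeps [y] positive. *)
assert (Hbox : forall s b, exists m M, 0 < m /\
  (exists G, forall g, G < g -> forall t, s <= t <= b -> m <= Y g t <= M) /\
  forall t, s <= t <= b -> m <= y t <= M).
{ intros s b. destruct (ham_box b d Hd) as [m [M [Hm [_ HB]]]].
  exists m, M. split; [exact Hm|].
  assert (HG : exists G, forall g, G < g -> forall t, s <= t <= b -> m <= Y g t <= M).
  { destruct (Htau s) as [G HG]. exists (Rmax G g0). intros g Hg t Ht.
    pose proof (Rmax_l G g0). pose proof (Rmax_r G g0).
    specialize (HG g ltac:(lra)).
    apply (HB t (Y g t) (V g t)); [lra|apply Hef; lra|apply Hham; lra]. }
  split; [exact HG|]. destruct HG as [G HG]. destruct (Hgam2 G) as [N HN].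
  intros t Ht. split.
  - apply (is_lim_seq_le_loc (fun _ => m) (fun n => Y (gam n) t) m (y t));
      [|apply is_lim_seq_const|apply Hyl].
    exists N. intros n Hn. apply HG; auto.
  - apply (is_lim_seq_le_loc (fun n => Y (gam n) t) (fun _ => M) (y t) M);
      [|apply Hyl|apply is_lim_seq_const].
    exists N. intros n Hn. apply HG; auto. }
assert (Hypos : forall t, 0 < y t).
{ intros t. destruct (Hbox t t) as [m [M [Hm [_ HB]]]]. destruct (HB t); lra. }
assert (Hself : forall c, Boule c (mkposreal 1 Rlt_0_1) c).
{ intros c. unfold Boule. simpl. rewrite Rminus_diag, Rabs_R0. lra. }
assert (Hyc : forall t, continuity_pt y t).
{ intros t. apply (CVU_continuity _ _ t _ (Hyu t)); [|apply Hself].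
  intros n x _. apply derivable_continuous_pt. exists (V (gam n) x).
  apply is_derive_Reals. apply (Hef _ (Hgam n) x). }
assert (Hvc : forall t, continuity_pt v t).
{ intros t. apply (CVU_continuity _ _ t _ (Hvu t)); [|apply Hself].
  intros n x _. apply derivable_continuous_pt. eexists.
  apply is_derive_Reals. apply (Hef _ (Hgam n) x). }
exists y, v. split; [|split; [|exact Hy]].
2:{ intros t.
  apply (is_lim_seq_le_loc (fun n => ham t (Y (gam n) t) (V (gam n) t)) (fun _ => - d)
    (ham t (y t) (v t)) (- d)); [|unfold ham|apply is_lim_seq_const].
  - destruct (Htau t) as [G HG]. destruct (Hgam2 G) as [N HN]. exists N.
    intros n Hn. apply Hham; [apply Hgam|apply HG, HN, Hn].
  - apply is_lim_seq_minus'; [apply is_lim_seq_plus'|].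
    + apply (is_lim_seq_continuous (fun x => x ^ 2 / 2) (fun n => V (gam n) t)); [reg|apply Hvl].
    + apply (is_lim_seq_continuous potential (fun n => Y (gam n) t)); [|apply Hyl].
      apply derivable_continuous_pt. exists (force (y t)).
      apply is_derive_Reals, is_derive_potential, Hypos.
    + apply (is_lim_seq_continuous (fun x => exp (2 * t) * x ^ 2 / 2) (fun n => Y (gam n) t));
        [reg|apply Hyl]. }
intros t. split; [apply Hypos|]. split.
- apply is_derive_Reals.
  apply (derivable_pt_lim_CVU (fun n => Y (gam n)) (fun n => V (gam n)) y v t t
    (mkposreal 1 Rlt_0_1)); [apply Hself| | |apply Hvu|].
  + intros x n _. apply is_derive_Reals. apply (Hef _ (Hgam n) x).
  + intros x _. apply is_lim_seq_Reals, Hyl.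
  + intros x _. apply Hvc.
- apply is_derive_Reals.
  apply (derivable_pt_lim_CVU (fun n => V (gam n))
    (fun n r => - al * V (gam n) r - force (Y (gam n) r) + exp (2 * r) * Y (gam n) r)
    v (fun r => - al * v r - force (y r) + exp (2 * r) * y r) t t
    (mkposreal 1 Rlt_0_1)); [apply Hself| | | |].
  + intros x n _. apply is_derive_Reals. apply (Hef _ (Hgam n) x).
  + intros x _. apply is_lim_seq_Reals, Hvl.
  + apply (Hlim (fun g r => - al * V g r - force (Y g r) + exp (2 * r) * Y g r)
      (fun r => - al * v r - force (y r) + exp (2 * r) * y r)).
    intros s b eps Hsb Heps.
    destruct (Hbox s b) as [m [M [Hm [[G0 HG0] HB]]]].
    destruct (force_lipschitz m M Hm) as [L [HL Hlip]].
    set (L' := al + L + exp (2 * b)).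
    pose proof (exp_pos (2 * b)) as Hb.
    assert (HL' : 0 < L') by (unfold L'; lra).
    assert (He : 0 < eps / L') by (apply Rdiv_lt_0_compat; lra).
    destruct (Hy s b _ Hsb He) as [G1 HG1]. destruct (Hv s b _ Hsb He) as [G2 HG2].
    exists (Rmax G0 (Rmax G1 G2)). intros g Hg r Hr.
    pose proof (Rmax_l G0 (Rmax G1 G2)). pose proof (Rmax_r G0 (Rmax G1 G2)).
    pose proof (Rmax_l G1 G2). pose proof (Rmax_r G1 G2).
    specialize (HG0 g ltac:(lra) r Hr). specialize (HG1 g ltac:(lra) r Hr).
    specialize (HG2 g ltac:(lra) r Hr). specialize (HB r Hr).
    specialize (Hlip (y r) (Y g r) HB HG0).
    assert (Hexp : 0 < exp (2 * r) <= exp (2 * b)).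
    { split; [apply exp_pos|]. destruct (Req_dec r b) as [->|]; [lra|].
      left; apply exp_increasing; lra. }
    replace (- al * V g r - force (Y g r) + exp (2 * r) * Y g r -
      (- al * v r - force (y r) + exp (2 * r) * y r)) with
      (- al * (V g r - v r) + - (force (Y g r) - force (y r)) + exp (2 * r) * (Y g r - y r))
      by ring.
    eapply Rle_trans; [apply Rabs_triang|].
    eapply Rle_trans; [apply Rplus_le_compat_r, Rabs_triang|].
    rewrite Rabs_Ropp, !Rabs_mult, Rabs_Ropp, (Rabs_pos_eq al), (Rabs_pos_eq (exp _)) by lra.
    replace eps with (L' * (eps / L')) by (field; lra).
    unfold L' at 1. rewrite !Rmult_plus_distr_r.
    apply Rplus_le_compat; [apply Rplus_le_compat|].
    * apply Rmult_le_compat_l; lra.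
    * eapply Rle_trans; [exact Hlip|]. apply Rmult_le_compat_l; lra.
    * apply Rmult_le_compat; try lra. apply Rabs_pos.
  + intros x _.
    apply (continuity_pt_plus (fun r => - al * v r - force (y r)) (fun r => exp (2 * r) * y r)).
    * apply (continuity_pt_minus (fun r => - al * v r) (fun r => force (y r))).
      -- apply (continuity_pt_scal v), Hvc.
      -- apply (continuity_pt_comp y force); [apply Hyc|].
         apply derivable_continuous_pt. eexists.
         apply is_derive_Reals, is_derive_force, Hypos.
    * apply (continuity_pt_mult (fun r => exp (2 * r)) y); [reg|apply Hyc].
Qed.

End EmdenFowler.

(** * Regular solutions near the origin *)

(** The data at 0 enter only through right-hand limits of [u] and [u'], so this stands in for a
    monotonicity argument on an interval starting at 0. *)
Lemma right_limit_ge (f : R -> R) (l s : R) : 0 < s ->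
  (forall r, 0 < r <= s -> f s <= f r) ->
  (forall eps, 0 < eps -> exists delta, 0 < delta /\
     forall r, 0 < r < delta -> Rabs (f r - l) < eps) ->
  f s <= l.
Proof.
intros Hs Hf Hl. destruct (Rle_lt_dec (f s) l) as [H|H]; [exact H|exfalso].
destruct (Hl (f s - l)) as [del [Hdel Hr]]; [lra|].
set (r := Rmin s (del / 2)).
assert (Hr0 : 0 < r) by (apply Rmin_glb_lt; lra).
assert (Hr1 : r <= s) by apply Rmin_l. assert (Hr2 : r <= del / 2) by apply Rmin_r.
specialize (Hr r ltac:(lra)). specialize (Hf r ltac:(lra)).
apply Rabs_def2 in Hr. lra.
Qed.

Lemma right_limit_le (f : R -> R) (l s : R) : 0 < s ->
  (forall r, 0 < r <= s -> f r <= f s) ->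
  (forall eps, 0 < eps -> exists delta, 0 < delta /\
     forall r, 0 < r < delta -> Rabs (f r - l) < eps) ->
  l <= f s.
Proof.
intros Hs Hf Hl. apply Ropp_le_cancel.
apply (right_limit_ge (fun r => - f r) (- l) s Hs).
- intros r Hr. specialize (Hf r Hr). lra.
- intros eps Heps. destruct (Hl eps Heps) as [del [Hdel H]]. exists del.
  split; [exact Hdel|]. intros r Hr. replace (- f r - - l) with (- (f r - l)) by ring.
  rewrite Rabs_Ropp. auto.
Qed.

Lemma fnl_force (p u : R) : 0 < u -> fnl p u = force p 1 u.
Proof.
intros Hu. unfold fnl, force. replace (Rpower u p) with (u * Rpower u (p - 1)); [ring|].
rewrite <- Rpower_S by exact Hu. f_equal; ring.
Qed.

(** The energy [du^2 / 2 + potential u] does not increase from its limit [potential gamma] at 0,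
    while [potential] is strictly increasing beyond 1. *)
Lemma ivp_le_gamma (N : nat) (p gamma : R) (u du ddu : R -> R) :
  (1 <= N)%nat -> 1 < p -> 1 <= gamma -> (forall s, 0 < s -> 0 < u s) ->
  radial_ode N p u du ddu ->
  (forall eps, 0 < eps -> exists delta, 0 < delta /\
     forall s, 0 < s < delta -> Rabs (u s - gamma) < eps /\ Rabs (du s) < eps) ->
  forall s, 0 < s -> u s <= gamma.
Proof.
intros HN Hp Hg Hu Hode Hlim s Hs.
assert (HN' : 1 <= INR N) by (apply (le_INR 1), HN).
assert (HF : du s ^ 2 / 2 + potential p 1 (u s) <= potential p 1 gamma).
{ apply (right_limit_ge (fun r => du r ^ 2 / 2 + potential p 1 (u r))); [exact Hs| |].
  - intros r Hr.
    apply (deriv_nonpos_le (fun r => du r ^ 2 / 2 + potential p 1 (u r))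
      (fun r => - ((INR N - 1) / r * du r ^ 2))); [lra| |].
    + intros x Hx. destruct (Hode x) as [Hd1 [Hd2 Heq]]; [lra|].
      apply is_derive_Reals in Hd1. apply is_derive_Reals in Hd2.
      assert (Hux : 0 < u x) by (apply Hu; lra).
      pose proof (is_derive_potential p 1 ltac:(lra) (u x) Hux) as HP.
      rewrite fnl_force in Heq by exact Hux.
      auto_derive; [repeat split; eexists; eassumption|].
      subst_derive Hd1. subst_derive Hd2. subst_derive HP.
      replace (ddu x) with (- (INR N - 1) / x * du x - force p 1 (u x)) by
        (unfold Rdiv in *; lra).
      field; lra.
    + intros x Hx. apply Ropp_le_cancel. rewrite Ropp_involutive, Ropp_0.
      apply Rmult_le_pos; [apply Rle_div_r; lra|apply pow2_ge_0].
  - intros eps Heps.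
    assert (Hcont : continuity_pt (potential p 1) gamma).
    { apply derivable_continuous_pt. eexists. apply is_derive_Reals, is_derive_potential; lra. }
    destruct (Hcont (eps / 2)) as [del [Hdel HD]]; [lra|].
    destruct (Hlim (Rmin del (Rmin 1 eps))) as [del2 [Hdel2 HD2]].
    { repeat apply Rmin_glb_lt; lra. }
    exists del2. split; [exact Hdel2|]. intros r Hr. destruct (HD2 r Hr) as [H1 H2].
    pose proof (Rmin_l del (Rmin 1 eps)). pose proof (Rmin_r del (Rmin 1 eps)).
    pose proof (Rmin_l 1 eps). pose proof (Rmin_r 1 eps).
    assert (H7 : Rabs (potential p 1 (u r) - potential p 1 gamma) < eps / 2).
    { destruct (Req_dec (u r) gamma) as [->|Hne].
      { rewrite Rminus_diag, Rabs_R0; lra. }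
      apply (HD (u r)). split; [split; [exact I|auto]|].
      simpl; unfold Rdist; lra. }
    assert (H8 : 0 <= du r ^ 2 / 2 < eps / 2).
    { rewrite <- pow2_abs. pose proof (Rabs_pos (du r)). nra. }
    apply Rabs_def2 in H7. apply Rabs_def1; lra. }
destruct (Rle_lt_dec (u s) gamma) as [H|H]; [exact H|exfalso].
destruct (MVT_cor2 (potential p 1) (force p 1) gamma (u s) H) as [c [Hc1 Hc2]].
{ intros x Hx. apply is_derive_Reals, is_derive_potential; lra. }
assert (0 < force p 1 c).
{ unfold force. apply Rmult_lt_0_compat; [lra|].
  assert (1 < Rpower c (p - 1)); [|lra].
  pose proof (Rpower_lt c 0 (p - 1) ltac:(lra) ltac:(lra)) as Hc3.
  rewrite Rpower_O in Hc3; lra. }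
pose proof (pow2_ge_0 (du s)). nra.
Qed.

(* Integrates [(s^(N-1) u')' = s^(N-1) (u - u^p)] using [u <= gamma]; the outcome [1 <= u] then
   gives the sign of [u']. *)
Lemma ivp_initial_layer (N : nat) (p gamma : R) (u du ddu : R -> R) :
  (2 <= N)%nat -> 1 < p -> 2 <= gamma -> (forall s, 0 < s -> 0 < u s) ->
  radial_ode N p u du ddu ->
  (forall eps, 0 < eps -> exists delta, 0 < delta /\
     forall s, 0 < s < delta -> Rabs (u s - gamma) < eps /\ Rabs (du s) < eps) ->
  forall s, 0 < s -> Rpower gamma (p - 1) * s ^ 2 <= INR N ->
  gamma / 2 <= u s <= gamma /\ - gamma * Rpower gamma (p - 1) * s <= INR N * du s <= 0.
Proof.
intros HN Hp Hg Hu Hode Hlim.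
assert (Hle : forall s, 0 < s -> u s <= gamma).
{ apply (ivp_le_gamma N p gamma u du ddu); auto; [lia|lra]. }
(* Writing [N] as [k + 2] makes the weight [s^(N-1)] the natural power [s^(S k)]; with [n = INR k]
   the dimension is [n + 2]. *)
destruct N as [|[|k]]; [lia|lia|].
rewrite !S_INR in *. pose proof (pos_INR k) as Hk0. set (n := INR k) in *.
assert (Hode' : forall s, 0 < s -> is_derive u s (du s) /\ is_derive du s (ddu s) /\
  ddu s = - ((n + 1) / s * du s) + u s - Rpower (u s) p).
{ intros s Hs. destruct (Hode s Hs) as [H1 [H2 H3]].
  split; [apply is_derive_Reals, H1|]. split; [apply is_derive_Reals, H2|].
  rewrite !S_INR in H3. fold n in H3. unfold fnl in H3.
  replace (n + 1 + 1 - 1) with (n + 1) in H3 by ring. lra. }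
set (B := Rpower gamma p).
assert (HB : B = gamma * Rpower gamma (p - 1)).
{ unfold B. rewrite <- Rpower_S by lra. f_equal; ring. }
assert (HBpos : 0 < B) by apply Rpower_pos.
assert (Hup : forall s, 0 < s -> Rpower (u s) p <= B).
{ intros s Hs. apply Rle_Rpower_l; [lra|]. split; [apply Hu|apply Hle]; exact Hs. }
(* The added term is [c * r^N / N]: [c = B] makes the flux nondecreasing and bounds [du] below, and
   [c = 0] later gives the sign of [du]. *)
assert (Hflux : forall c r, 0 < r ->
  is_derive (fun r => r ^ (S k) * du r + c * (r ^ (S (S k)) / (n + 2))) r
    (r ^ (S k) * (u r - Rpower (u r) p + c))).
{ intros c r Hr. destruct (Hode' r Hr) as [H1 [H2 H3]].
  auto_derive; [eexists; exact H2|]. subst_derive H2. rewrite H3.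
  rewrite ?S_INR; fold n. destruct k as [|k].
  - unfold n in *; simpl. field. lra.
  - rewrite <- !tech_pow_Rmult. fold n.
    change (match k with O => 1 | S _ => INR k + 1 end) with (INR (S k)).
    fold n. simpl pred. rewrite <- ?tech_pow_Rmult. field. split; lra. }
assert (Hflux0 : forall c eps, 0 < eps -> exists delta, 0 < delta /\
   forall r, 0 < r < delta ->
     Rabs (r ^ (S k) * du r + c * (r ^ (S (S k)) / (n + 2)) - 0) < eps).
{ intros c eps Heps. destruct (Hlim (eps / 2)) as [del [Hdel HD]]; [lra|].
  assert (Hq : 0 < eps / 2 / (Rabs c + 1)).
  { pose proof (Rabs_pos c). apply Rdiv_lt_0_compat; lra. }
  exists (Rmin del (Rmin 1 (eps / 2 / (Rabs c + 1)))).
  split; [repeat apply Rmin_glb_lt; lra|].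
  intros r [Hr0 Hr].
  assert (Hr1 : r < del /\ r < 1 /\ r < eps / 2 / (Rabs c + 1)).
  { repeat split; (eapply Rlt_le_trans; [exact Hr|]).
    - apply Rmin_l.
    - eapply Rle_trans; [apply Rmin_r|apply Rmin_l].
    - eapply Rle_trans; [apply Rmin_r|apply Rmin_r]. }
  destruct Hr1 as [Hr1 [Hr2 Hr3]].
  destruct (HD r) as [_ HDr]; [lra|].
  assert (Hpow : forall j, 0 < r ^ j <= 1).
  { intros j. split; [apply pow_lt; lra|]. rewrite <- (pow1 j). apply pow_incr; lra. }
  rewrite Rminus_0_r. eapply Rle_lt_trans; [apply Rabs_triang|].
  rewrite !Rabs_mult, (Rabs_pos_eq (r ^ S k)) by (left; apply Hpow).
  rewrite (Rabs_pos_eq (r ^ (S (S k)) / (n + 2))).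
  2:{ apply Rle_div_r; [lra|]. rewrite Rmult_0_l. left; apply Hpow. }
  assert (E1 : r ^ S k * Rabs (du r) <= Rabs (du r)).
  { destruct (Hpow (S k)). pose proof (Rabs_pos (du r)). nra. }
  assert (E2 : r ^ (S (S k)) / (n + 2) <= r).
  { apply Rle_div_l; [lra|]. rewrite <- tech_pow_Rmult. destruct (Hpow (S k)). nra. }
  assert (E3 : (Rabs c + 1) * r < eps / 2).
  { replace (eps / 2) with ((Rabs c + 1) * (eps / 2 / (Rabs c + 1))).
    - pose proof (Rabs_pos c). apply Rmult_lt_compat_l; lra.
    - field. pose proof (Rabs_pos c). lra. }
  pose proof (Rabs_pos c). nra. }
assert (Hdu : forall s, 0 < s -> - B * s <= (n + 2) * du s).
{ intros s Hs.
  assert (H : 0 <= s ^ (S k) * du s + B * (s ^ (S (S k)) / (n + 2))).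
  { apply (right_limit_le (fun r => r ^ (S k) * du r + B * (r ^ (S (S k)) / (n + 2))));
      [exact Hs| |apply Hflux0].
    intros r Hr. eapply (deriv_nonneg_le
      (fun r => r ^ (S k) * du r + B * (r ^ (S (S k)) / (n + 2)))); [lra| |].
    - intros x Hx. apply Hflux; lra.
    - intros x Hx. apply Rmult_le_pos; [apply pow_le; lra|].
      pose proof (Hup x ltac:(lra)). pose proof (Hu x ltac:(lra)). lra. }
  assert (Hsk : 0 < s ^ S k) by (apply pow_lt; lra).
  replace (s ^ S k * du s + B * (s ^ S (S k) / (n + 2)))
    with (s ^ S k * ((n + 2) * du s + B * s) / (n + 2)) in H
    by (rewrite <- (tech_pow_Rmult s (S k)); field; lra).
  apply Rle_div_r in H; [|lra]. rewrite Rmult_0_l in H.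
  assert (0 <= (n + 2) * du s + B * s); [|lra].
  apply (Rmult_le_reg_l (s ^ S k)); lra. }
assert (Hlow : forall s, 0 < s -> gamma <= u s + B * s ^ 2 / (2 * (n + 2))).
{ intros s Hs.
  apply (right_limit_le (fun r => u r + B * r ^ 2 / (2 * (n + 2)))); [exact Hs| |].
  - intros r Hr. apply (deriv_nonneg_le (fun r => u r + B * r ^ 2 / (2 * (n + 2)))
      (fun r => du r + B * r / (n + 2))); [lra| |].
    + intros x Hx. destruct (Hode' x) as [H1 _]; [lra|].
      auto_derive; [eexists; exact H1|]. subst_derive H1. field; lra.
    + intros x Hx. pose proof (Hdu x ltac:(lra)).
      replace (du x + B * x / (n + 2)) with (((n + 2) * du x + B * x) / (n + 2)) by (field; lra).
      apply Rle_div_r; lra.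
  - intros eps Heps. destruct (Hlim (eps / 2)) as [del [Hdel HD]]; [lra|].
    assert (Hq : 0 < eps / 2 / B) by (apply Rdiv_lt_0_compat; lra).
    exists (Rmin del (Rmin 1 (eps / 2 / B))). split; [repeat apply Rmin_glb_lt; lra|].
    intros r [Hr0 Hr].
    assert (Hr1 : r < del /\ r < 1 /\ r < eps / 2 / B).
    { repeat split; (eapply Rlt_le_trans; [exact Hr|]).
      - apply Rmin_l.
      - eapply Rle_trans; [apply Rmin_r|apply Rmin_l].
      - eapply Rle_trans; [apply Rmin_r|apply Rmin_r]. }
    destruct Hr1 as [Hr1 [Hr2 Hr3]]. destruct (HD r) as [HDr _]; [lra|].
    assert (E1 : 0 <= B * r ^ 2 / (2 * (n + 2)) < eps / 2).
    { split; [apply Rle_div_r; [lra|]; rewrite Rmult_0_l; apply Rmult_le_pos;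
        [lra|apply pow2_ge_0]|].
      apply Rlt_div_l; [lra|].
      replace (eps / 2) with (B * (eps / 2 / B)) by (field; lra).
      assert (r ^ 2 <= r) by nra. rewrite Rmult_assoc.
      apply Rmult_lt_compat_l; [lra|]. nra. }
    apply Rabs_def2 in HDr. apply Rabs_def1; lra. }
intros s Hs Hsmall.
(* [gamma^(p-1) * s^2 <= N] is what makes the loss [B * s^2 / (2 * N)] at most [gamma / 2]. *)
assert (Hhalf : forall r, 0 < r <= s -> gamma / 2 <= u r).
{ intros r Hr. pose proof (Hlow r ltac:(lra)) as Hl.
  assert (B * r ^ 2 / (2 * (n + 2)) <= gamma / 2); [|lra].
  apply Rle_div_l; [lra|]. rewrite HB.
  assert (r ^ 2 <= s ^ 2) by (apply pow_incr; lra).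
  pose proof (Rpower_pos gamma (p - 1)).
  assert (Rpower gamma (p - 1) * r ^ 2 <= n + 1 + 1) by nra.
  nra. }
split; [split; [apply Hhalf; lra|apply Hle, Hs]|].
split.
- pose proof (Hdu s Hs). rewrite HB in H. lra.
- assert (H : s ^ (S k) * du s + 0 * (s ^ (S (S k)) / (n + 2)) <= 0).
  { apply (right_limit_ge (fun r => r ^ (S k) * du r + 0 * (r ^ (S (S k)) / (n + 2))));
      [exact Hs| |apply Hflux0].
    intros r Hr. eapply (deriv_nonpos_le
      (fun r => r ^ (S k) * du r + 0 * (r ^ (S (S k)) / (n + 2)))); [lra| |].
    - intros x Hx. apply Hflux; lra.
    - intros x Hx. cbv beta. assert (Hux : gamma / 2 <= u x) by (apply Hhalf; lra).
      assert (u x <= Rpower (u x) p).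
      { rewrite <- (Rpower_1 (u x)) at 1 by lra. apply Rle_Rpower; lra. }
      assert (0 < x ^ S k) by (apply pow_lt; lra). nra. }
  assert (Hsk : 0 < s ^ S k) by (apply pow_lt; lra).
  assert (du s <= 0) by (apply (Rmult_le_reg_l (s ^ S k)); lra).
  nra.
Qed.

(** * Change of variables between [u(s)] and [y(t)] *)

Definition ef_y (th : R) (u : R -> R) (t : R) : R := exp (th * t) * u (exp t).
Definition ef_v (th : R) (u du : R -> R) (t : R) : R :=
  exp (th * t) * (th * u (exp t) + exp t * du (exp t)).

(** With [s = exp t], [y^(p-1)] is [s^2 * u^(p-1)], and [s^2] is precisely the factor produced by
    passing to logarithmic time; this is why the nonlinear term carries no explicit [t]. *)
Lemma ef_power (p th t u : R) : th * (p - 1) = 2 -> 0 < u ->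
  Rpower (exp (th * t) * u) (p - 1) = exp t ^ 2 * Rpower u (p - 1).
Proof.
intros Hth Hu. rewrite <- Rpower_mult_distr by (auto; apply exp_pos).
f_equal. unfold Rpower at 1. rewrite ln_exp.
replace ((p - 1) * (th * t)) with (th * (p - 1) * t) by ring. rewrite Hth.
simpl. rewrite Rmult_1_r, <- exp_plus. f_equal; ring.
Qed.

Lemma ef_sol_of_radial (N : nat) (p th : R) (u du ddu : R -> R) :
  th * (p - 1) = 2 -> (forall s, 0 < s -> 0 < u s) -> radial_ode N p u du ddu ->
  ef_sol p (INR N - 2 - 2 * th) (th * (INR N - 2 - th)) (ef_y th u) (ef_v th u du).
Proof.
intros Hth Hu Hode t. pose proof (exp_pos t) as Het. pose proof (exp_pos (th * t)) as Heth.
destruct (Hode (exp t) Het) as [H1 [H2 H3]].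
apply is_derive_Reals in H1. apply is_derive_Reals in H2.
rewrite fnl_force in H3 by (apply Hu, Het). unfold force in *.
split; [|split].
- unfold ef_y. apply Rmult_lt_0_compat; auto.
- unfold ef_y, ef_v. auto_derive; [eexists; exact H1|]. subst_derive H1. ring.
- unfold ef_y, ef_v. auto_derive; [repeat split; eexists; eassumption|].
  subst_derive H1. subst_derive H2.
  rewrite ef_power by auto.
  replace (exp (2 * t)) with (exp t ^ 2)
    by (simpl; rewrite Rmult_1_r, <- exp_plus; f_equal; ring).
  replace (ddu (exp t)) with (- ((INR N - 1) / exp t * du (exp t))
    - u (exp t) * (Rpower (u (exp t)) (p - 1) - 1)) by lra.
  field. lra.
Qed.

Lemma radial_of_ef_sol (N : nat) (p th : R) (y v : R -> R) :
  th * (p - 1) = 2 ->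
  ef_sol p (INR N - 2 - 2 * th) (th * (INR N - 2 - th)) y v ->
  exists du ddu,
    radial_ode N p (fun s => exp (- th * ln s) * y (ln s)) du ddu.
Proof.
intros Hth Hef.
set (u := fun s => exp (- th * ln s) * y (ln s)).
(* The relation [v = s^th * (th * u + s * u')] is solved for [u']; [ddu] is read off from the
   equation, so the work lies in differentiating [du]. *)
exists (fun s => exp (- th * ln s) / s * (v (ln s) - th * y (ln s))).
exists (fun s => - ((INR N - 1) / s * (exp (- th * ln s) / s * (v (ln s) - th * y (ln s))))
  - fnl p (u s)).
intros s Hs. destruct (Hef (ln s)) as [Hy [H1 H2]].
assert (Hu : 0 < u s) by (apply Rmult_lt_0_compat; [apply exp_pos|exact Hy]).
split; [|split; [|ring]]; apply is_derive_Reals.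
- unfold u. auto_derive; [split; [exact Hs|]; split; [eexists; exact H1|auto]|].
  subst_derive H1. field. lra.
- auto_derive.
  { repeat split; auto; try lra; eexists; eassumption. }
  subst_derive H1. subst_derive H2.
  rewrite fnl_force by exact Hu. unfold force.
  replace (y (ln s)) with (exp (th * ln s) * u s).
  2:{ unfold u. rewrite <- Rmult_assoc, <- exp_plus.
      replace (th * ln s + - th * ln s) with 0 by ring. rewrite exp_0. ring. }
  rewrite ef_power by auto.
  replace (exp (2 * ln s)) with (exp (ln s) ^ 2)
    by (simpl; rewrite Rmult_1_r, <- exp_plus; f_equal; ring).
  rewrite exp_ln by exact Hs.
  replace (exp (- th * ln s)) with (/ exp (th * ln s))
    by (rewrite <- exp_Ropp; f_equal; ring).
  pose proof (exp_pos (th * ln s)). field. lra.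
Qed.

(** At the time [tau] with [gamma^(p-1) * exp (2 * tau) = ka] the initial layer gives
    [v^2 <= th^2 * y^2]. As [th^2 - a = - th * al], the quadratic part is at most
    [- th * al * y^2 / 2], and [ka] is small enough for the power term to use up only half of this.
    Later times follow by monotonicity. *)
Lemma ivp_ham (N : nat) (p th gamma ka : R) (u du ddu : R -> R) :
  (3 <= N)%nat -> 0 < th -> th * (p - 1) = 2 -> 0 < INR N - 2 - 2 * th ->
  2 <= gamma -> (forall s, 0 < s -> 0 < u s) -> radial_ode N p u du ddu ->
  (forall eps, 0 < eps -> exists delta, 0 < delta /\
     forall s, 0 < s < delta -> Rabs (u s - gamma) < eps /\ Rabs (du s) < eps) ->
  0 < ka -> ka <= INR N -> ka <= th * INR N ->
  ka <= (p + 1) * th * (INR N - 2 - 2 * th) / 4 ->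
  forall t, (ln ka - (p - 1) * ln gamma) / 2 <= t ->
  ham p (th * (INR N - 2 - th)) t (ef_y th u t) (ef_v th u du t) <=
    - (th * (INR N - 2 - 2 * th) / 4 * (Rpower ka (th / 2) / 2) ^ 2).
Proof.
intros HN Hth0 Hth Hal Hg Hu Hode Hlim Hka Hka1 Hka2 Hka3 t Ht.
assert (Hp : 1 < p) by nra.
set (al := INR N - 2 - 2 * th) in *. set (a := th * (INR N - 2 - th)).
assert (HN3 : 3 <= INR N) by (apply (le_INR 3) in HN; simpl in HN; lra).
pose proof (ef_sol_of_radial N p th u du ddu Hth Hu Hode) as Hef.
fold al a in Hef.
set (tau := (ln ka - (p - 1) * ln gamma) / 2) in *.
eapply Rle_trans; [apply (ham_decreasing p al a Hp Hal _ _ tau t Hef Ht)|].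
assert (Hs : 0 < exp tau) by apply exp_pos.
assert (Hsg : Rpower gamma (p - 1) * exp tau ^ 2 = ka).
{ unfold Rpower. simpl. rewrite Rmult_1_r, <- !exp_plus. rewrite <- (exp_ln ka) by lra.
  f_equal. unfold tau. field. }
destruct (ivp_initial_layer N p gamma u du ddu) with (s := exp tau)
  as [Hu1 Hdu1]; auto; [lia|lra|].
(* The powers of [gamma] cancel because [th * (p - 1) = 2]; hence a lower bound for [y] free of
   [gamma]. *)
assert (HE : exp (th * tau) * gamma = Rpower ka (th / 2)).
{ unfold Rpower. rewrite <- (exp_ln gamma) at 1 by lra. rewrite <- exp_plus. f_equal.
  unfold tau.
  replace (th * ((ln ka - (p - 1) * ln gamma) / 2) + ln gamma)
    with (th / 2 * ln ka - (th * (p - 1)) / 2 * ln gamma + ln gamma) by field.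
  rewrite Hth. field. }
assert (Hypow : Rpower (ef_y th u tau) (p - 1) <= ka).
{ unfold ef_y. rewrite ef_power by auto. rewrite <- Hsg, Rmult_comm.
  apply Rmult_le_compat_r; [apply pow2_ge_0|]. apply Rle_Rpower_l; lra. }
assert (Hy0 : Rpower ka (th / 2) / 2 <= ef_y th u tau).
{ rewrite <- HE. unfold ef_y. pose proof (exp_pos (th * tau)). nra. }
assert (Hv : ef_v th u du tau ^ 2 <= th ^ 2 * ef_y th u tau ^ 2).
{ unfold ef_v, ef_y. set (E := exp (th * tau)). set (U := u (exp tau)) in *.
  set (D := exp tau * du (exp tau)).
  assert (HD : - th * gamma <= D <= 0).
  { assert (HD1 : - gamma * ka <= INR N * D <= 0).
    { rewrite <- Hsg. unfold D. split.
      - replace (- gamma * (Rpower gamma (p - 1) * exp tau ^ 2))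
          with (exp tau * (- gamma * Rpower gamma (p - 1) * exp tau)) by ring.
        replace (INR N * (exp tau * du (exp tau)))
          with (exp tau * (INR N * du (exp tau))) by ring.
        apply Rmult_le_compat_l; lra.
      - replace (INR N * (exp tau * du (exp tau)))
          with (exp tau * (INR N * du (exp tau))) by ring. nra. }
    split; [|nra]. apply (Rmult_le_reg_l (INR N)); [lra|].
    apply Rle_trans with (- gamma * ka); [|lra]. nra. }
  rewrite <- !Rpow_mult_distr.
  replace (th * (E * U)) with (E * (th * U)) by ring.
  rewrite !Rpow_mult_distr. apply Rmult_le_compat_l; [apply pow2_ge_0|].
  assert (HthU : th * gamma <= 2 * (th * U)) by nra.
  rewrite <- Rpow_mult_distr. nra. }
assert (HypS : Rpower (ef_y th u tau) (p + 1) =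
  ef_y th u tau ^ 2 * Rpower (ef_y th u tau) (p - 1)).
{ destruct (Hef tau) as [Hy _]. replace (p + 1) with (p - 1 + 1 + 1) by ring.
  rewrite !Rpower_S by exact Hy. ring. }
pose proof (Rpower_pos ka (th / 2)) as Hkp.
unfold ham, potential. rewrite HypS.
set (y := ef_y th u tau) in *. set (v := ef_v th u du tau) in *.
set (q := Rpower y (p - 1)) in *.
assert (Hq : q / (p + 1) <= th * al / 4).
{ apply Rle_div_l; [lra|]. lra. }
pose proof (exp_pos (2 * tau)) as He.
assert (Hy2 : (Rpower ka (th / 2) / 2) ^ 2 <= y ^ 2) by (apply pow_incr; lra).
assert (Hthal : 0 < th * al) by (apply Rmult_lt_0_compat; lra).
replace (y ^ 2 * q / (p + 1)) with (y ^ 2 * (q / (p + 1))) by (field; lra).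
assert (Hy2p : 0 <= y ^ 2) by apply pow2_ge_0.
assert (I1 : y ^ 2 * (q / (p + 1)) <= y ^ 2 * (th * al / 4)) by (apply Rmult_le_compat_l; lra).
assert (I2 : 0 <= exp (2 * tau) * y ^ 2) by (apply Rmult_le_pos; lra).
assert (I3 : th * al / 4 * (Rpower ka (th / 2) / 2) ^ 2 <= th * al / 4 * y ^ 2)
  by (apply Rmult_le_compat_l; lra).
replace (a * y ^ 2) with (th ^ 2 * y ^ 2 + th * al * y ^ 2) by (unfold a, al; ring).
lra.
Qed.

(** * Oscillation *)

Lemma Rpower_base_1 (x : R) : Rpower 1 x = 1.
Proof. unfold Rpower. rewrite ln_1, Rmult_0_r. apply exp_0. Qed.

(* [rho = w'/w] satisfies [rho' <= - ka (1 + rho^2)], so [atan rho + ka s] is nonincreasing. *)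
Lemma riccati_blowup (w dw ddw : R -> R) (m c0 S : R) : 0 < S -> 0 < c0 ->
  (forall s, S <= s -> w s <> 0 /\ is_derive w s (dw s) /\ is_derive dw s (ddw s) /\
    exists c, c0 <= c /\ ddw s = - (m / s * dw s) - c * w s) ->
  False.
Proof.
intros HS Hc0 Hw.
set (ka := Rmin (1 / 2) (c0 / 2)).
assert (Hka : 0 < ka) by (apply Rmin_glb_lt; lra).
assert (Hka1 : ka <= 1 / 2) by apply Rmin_l. assert (Hka2 : ka <= c0 / 2) by apply Rmin_r.
clearbody ka.
(* Beyond [T] one has [(m / s)^2 <= c0], so the friction term is absorbed by half of [r^2] and half
   of [c0]. *)
set (T := Rmax S (m ^ 2 / c0 + 1)).
assert (HT1 : S <= T) by apply Rmax_l. assert (HT2 : m ^ 2 / c0 + 1 <= T) by apply Rmax_r.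
clearbody T.
assert (Hmc : 0 <= m ^ 2 / c0) by (apply Rle_div_r; [lra|rewrite Rmult_0_l; apply pow2_ge_0]).
(* Up to [T'] the term [ka * s] grows by [PI + 1], more than [atan] can drop. *)
set (T' := T + (PI + 1) / ka).
assert (HPI := PI_RGT_0).
assert (HT' : T <= T').
{ unfold T'. assert (0 < (PI + 1) / ka) by (apply Rdiv_lt_0_compat; lra). lra. }
assert (H : atan (dw T' / w T') + ka * T' <= atan (dw T / w T) + ka * T).
{ apply (deriv_nonpos_le (fun s => atan (dw s / w s) + ka * s)
   (fun s => / (1 + (dw s / w s) ^ 2) * ((ddw s * w s - dw s * dw s) / w s ^ 2) + ka));
   [exact HT'| |].
  - intros s Hs. destruct (Hw s) as [Hw0 [H1 [H2 _]]]; [lra|].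
    pose proof (pow2_ge_0 (dw s / w s)) as Hsq.
    auto_derive; [repeat split; auto; eexists; eassumption|].
    subst_derive H1. subst_derive H2.
    assert (w s * w s + dw s * dw s <> 0).
    { assert (0 < w s * w s) by (apply Rsqr_pos_lt, Hw0). pose proof (Rle_0_sqr (dw s)).
      unfold Rsqr in *. lra. }
    field. repeat split; auto; unfold Rsqr; simpl; nra.
  - intros s Hs. destruct (Hw s) as [Hw0 [H1 [H2 [c [Hc Heq]]]]]; [lra|].
    assert (Hs0 : 0 < s) by lra.
    rewrite Heq. set (r := dw s / w s).
    replace ((( - (m / s * dw s) - c * w s) * w s - dw s * dw s) / w s ^ 2)
      with (- (m / s) * r - c - r ^ 2) by (unfold r; field; lra).
    pose proof (pow2_ge_0 r) as Hr.
    assert (Hms : (m / s) ^ 2 <= c0).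
    { replace ((m / s) ^ 2) with (m ^ 2 / s ^ 2) by (field; lra).
      apply Rle_div_l; [apply pow_lt; lra|].
      assert (m ^ 2 <= c0 * s).
      { assert (Hx : m ^ 2 / c0 <= s) by lra. apply Rle_div_l in Hx; [|lra]. lra. }
      assert (1 <= s) by lra. nra. }
    assert (- (m / s) * r - c - r ^ 2 <= - ka * (1 + r ^ 2)).
    { pose proof (pow2_ge_0 (r + m / s)). nra. }
    replace ka with (/ (1 + r ^ 2) * (ka * (1 + r ^ 2))) at 1 by (field; lra).
    rewrite <- Rmult_plus_distr_l.
    assert (0 < / (1 + r ^ 2)) by (apply Rinv_0_lt_compat; lra). nra. }
destruct (atan_bound (dw T' / w T')). destruct (atan_bound (dw T / w T)).
replace (ka * T') with (ka * T + (PI + 1)) in H by (unfold T'; field; lra).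
lra.
Qed.

(** The derivative [p * z^(p-1) - 1] is at least [p - 1] for [z >= 1], so the slope bound is uniform
    on an unbounded range, unlike in [force_slope]. *)
Lemma force_above_one (p u : R) : 1 < p -> 1 <= u ->
  exists c, p - 1 <= c /\ force p 1 u = c * (u - 1).
Proof.
intros Hp Hu. destruct (force_MVT p 1 1 u) as [z [Hz Hf]]; [lra|lra|].
exists (p * Rpower z (p - 1) - 1).
assert (H1 : force p 1 1 = 0) by (unfold force; rewrite Rpower_base_1; ring).
rewrite H1, Rminus_0_r in Hf. split; [|exact Hf].
assert (Hz1 : 1 <= z) by (rewrite Rmin_left in Hz; lra).
assert (1 <= Rpower z (p - 1)).
{ rewrite <- (Rpower_base_1 (p - 1)) at 1. apply Rle_Rpower_l; lra. }
nra.
Qed.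

Section Oscillation.

Variables (N : nat) (p r c : R) (u du ddu : R -> R).
Hypotheses (HN : (2 <= N)%nat) (Hp : 1 < p) (Hc : 0 < c).
Hypothesis Hu : forall s, 0 < s -> 0 < u s.
Hypothesis Hode : radial_ode N p u du ddu.
Hypothesis Hsing : forall M, exists delta, 0 < delta /\ forall s, 0 < s < delta -> M < u s.
Hypothesis Hlow : forall s, 1 <= s -> c <= Rpower s r * u s.

Lemma radial_derivs : forall s, 0 < s -> is_derive u s (du s) /\ is_derive du s (ddu s) /\
  ddu s = - ((INR N - 1) / s * du s) - force p 1 (u s).
Proof.
intros s Hs. destruct (Hode s Hs) as [H1 [H2 H3]].
split; [apply is_derive_Reals, H1|]. split; [apply is_derive_Reals, H2|].
rewrite fnl_force in H3 by (apply Hu, Hs). lra.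
Qed.

Lemma INR_N_minus_1 : 1 <= INR N - 1.
Proof. apply (le_INR 2) in HN. simpl in HN. lra. Qed.

Lemma potential_above_one (x : R) : 0 < x -> x <> 1 ->
  potential p 1 1 < potential p 1 x.
Proof.
intros Hx Hx1.
assert (HD : forall z, 0 < z -> derivable_pt_lim (potential p 1) z (force p 1 z)).
{ intros z Hz. apply is_derive_Reals, is_derive_potential; lra. }
destruct (Rlt_le_dec x 1) as [H|H].
- destruct (MVT_cor2 (potential p 1) (force p 1) x 1 H) as [z [Hz1 Hz2]].
  { intros z Hz; apply HD; lra. }
  assert (Rpower z (p - 1) < 1).
  { rewrite <- (Rpower_base_1 (p - 1)) at 2. apply Rlt_Rpower_l; lra. }
  assert (force p 1 z < 0) by (unfold force; nra). nra.
- destruct (MVT_cor2 (potential p 1) (force p 1) 1 x) as [z [Hz1 Hz2]]; [lra| |].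
  { intros z Hz; apply HD; lra. }
  destruct (force_above_one p z Hp) as [k [Hk1 Hk2]]; [lra|].
  assert (0 < force p 1 z) by (rewrite Hk2; nra). nra.
Qed.

(* The energy excess [du^2/2 + potential u - potential 1] multiplied by [s^(2(N-1))] is
   nondecreasing, so it cannot vanish once it has been positive. *)
Lemma no_rest_point (s : R) : 0 < s -> u s = 1 -> du s = 0 -> False.
Proof.
intros Hs Hus Hdus. pose proof INR_N_minus_1 as HN1.
destruct (Hsing 1) as [del [Hdel Hd]].
set (s0 := Rmin (del / 2) s).
assert (Hs0 : 0 < s0) by (apply Rmin_glb_lt; lra).
assert (Hs0s : s0 <= s) by apply Rmin_r. assert (Hs0d : s0 <= del / 2) by apply Rmin_l.
assert (Hus0 : 1 < u s0) by (apply Hd; lra).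
set (m := 2 * (INR N - 1)).
pose (D := fun s => du s ^ 2 / 2 + potential p 1 (u s) - potential p 1 1).
assert (H : Rpower s0 m * D s0 <= Rpower s m * D s).
{ apply (deriv_nonneg_le (fun s => Rpower s m * D s)
    (fun s => Rpower s m * (m / s * (potential p 1 (u s) - potential p 1 1))));
    [exact Hs0s| |].
  - intros x Hx. assert (Hx0 : 0 < x) by lra.
    destruct (radial_derivs x Hx0) as [H1 [H2 H3]].
    pose proof (is_derive_potential p 1 Hp (u x) (Hu x Hx0)) as HP.
    pose proof (is_derive_Rpower m x Hx0) as HR.
    unfold D. auto_derive; [repeat split; eexists; eassumption|].
    replace (Derive (fun x => Rpower x m) x) with (m / x * Rpower x m).
    2:{ symmetry; etransitivity; [exact (is_derive_unique _ _ _ HR)|].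
        replace (Rpower x m) with (x * Rpower x (m - 1)); [field; lra|].
        rewrite <- Rpower_S by lra. f_equal; ring. }
    subst_derive H1. subst_derive H2. subst_derive HP. rewrite H3. unfold m. field. lra.
  - intros x Hx. apply Rmult_le_pos; [left; apply Rpower_pos|].
    apply Rmult_le_pos; [apply Rle_div_r; unfold m; lra|].
    destruct (Req_dec (u x) 1) as [->|Hne]; [lra|].
    pose proof (potential_above_one (u x) (Hu x ltac:(lra)) Hne). lra. }
assert (HD : D s = 0) by (unfold D; rewrite Hus, Hdus; field).
rewrite HD, Rmult_0_r in H.
assert (0 < D s0).
{ unfold D. pose proof (potential_above_one (u s0) ltac:(lra) ltac:(lra)).
  pose proof (pow2_ge_0 (du s0)). lra. }
pose proof (Rpower_pos s0 m). nra.
Qed.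

Lemma interior_min_critical (s a b sg : R) : 0 < a -> a < s < b ->
  (forall x, a < x < b -> sg * u s <= sg * u x) -> sg <> 0 -> du s = 0.
Proof.
intros Ha Hs Hmin Hsg. destruct (radial_derivs s) as [H1 _]; [lra|].
assert (HD : derivable_pt_lim (fun x => sg * u x) s (sg * du s)).
{ apply is_derive_Reals. apply (is_derive_scal u s sg (du s)) in H1. exact H1. }
pose proof (deriv_minimum (fun x => sg * u x) a b s (exist _ _ HD)
  ltac:(lra) ltac:(lra) (fun x h1 h2 => Hmin x (conj h1 h2))) as H.
simpl in H. apply Rmult_integral in H. tauto.
Qed.

(** Otherwise touching 1 from above would be a minimum, hence a rest point; so [u > 1] strictly, and
    [u - 1] falls under [riccati_blowup] with [c >= p - 1]. *)
Lemma below_one_infinitely_often (S : R) : exists s, S < s /\ 0 < s /\ u s < 1.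
Proof.
destruct (Classical_Prop.classic (exists s, S < s /\ 0 < s /\ u s < 1)) as [H|H];
  [exact H|exfalso].
set (S0 := Rmax S 0). assert (HS1 : S <= S0) by apply Rmax_l.
assert (HS2 : 0 <= S0) by apply Rmax_r. clearbody S0.
assert (Hge : forall s, S0 < s -> 1 <= u s).
{ intros s Hs. apply Rnot_lt_le. intro Hlt. apply H. exists s. lra. }
assert (Hgt : forall s, S0 + 1 <= s -> 1 < u s).
{ intros s Hs. destruct (Hge s) as [Hs1|Hs1]; [lra|exact Hs1|exfalso].
  apply (no_rest_point s); [lra|auto|].
  apply (interior_min_critical s (s - 1 / 2) (s + 1 / 2) 1); [lra|lra| |lra].
  intros x Hx. pose proof (Hge x ltac:(lra)). lra. }
apply (riccati_blowup (fun s => u s - 1) du ddu (INR N - 1) (p - 1) (S0 + 1)); [lra|lra|].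
intros s Hs. specialize (Hgt s Hs). destruct (radial_derivs s) as [H1 [H2 H3]]; [lra|].
split; [lra|]. split; [|split; [exact H2|]].
- auto_derive; [eexists; exact H1|]. subst_derive H1. ring.
- destruct (force_above_one p (u s) Hp) as [k [Hk1 Hk2]]; [lra|].
  exists k. split; [exact Hk1|]. rewrite H3, Hk2. reflexivity.
Qed.

(** The slope [force u / (u - 1)] degenerates as [u] tends to 0; the bound [m] keeps it away from 0,
    so [riccati_blowup] applies to [u - 1]. *)
Lemma not_trapped_below_one (S m : R) : 0 < S -> 0 < m ->
  (forall s, S <= s -> m <= u s < 1) -> False.
Proof.
intros HS Hm Hb.
assert (Hm1 : m <= 1) by (destruct (Hb S); lra).
destruct (force_slope p 1 1 Hp Rlt_0_1 (Rpower_base_1 (p - 1)) m 1 Hm ltac:(lra))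
  as [k0 [L [Hk0 [HL Hk]]]].
apply (riccati_blowup (fun s => u s - 1) du ddu (INR N - 1) k0 S HS Hk0).
intros s Hs. specialize (Hb s Hs). destruct (radial_derivs s) as [H1 [H2 H3]]; [lra|].
split; [lra|]. split; [|split; [exact H2|]].
- auto_derive; [eexists; exact H1|]. subst_derive H1. ring.
- destruct (Hk (u s)) as [k [Hk1 Hk2]]; [lra|].
  exists k. split; [lra|]. rewrite H3, Hk2. reflexivity.
Qed.

(* [q = u' + u/2] satisfies [q' >= q/2], so boundedness of [u] forces [q <= 0] and exponential
   decay, against the power lower bound. *)
Lemma not_decaying (S : R) : 0 < S ->
  (forall s, S <= s -> du s < 0 /\ Rpower (u s) (p - 1) <= 1 / 2) -> False.
Proof.
intros HS Hd. pose proof INR_N_minus_1 as HN1.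
assert (Hq : forall s, S <= s -> du s <= - (1 / 2) * u s).
{ intros s2 Hs2. apply Rnot_lt_le. intro Hlt.
  set (q := fun s => du s + 1 / 2 * u s).
  assert (Hq2 : 0 < q s2) by (unfold q; lra).
  (* By [s3] the exponential growth of [q] has gained more than [u s2 / 2], while [du < 0] forces
     [q < u / 2] with [u] decreasing. *)
  set (s3 := s2 + u s2 / q s2).
  assert (Hs23 : 0 < u s2 / q s2) by (apply Rdiv_lt_0_compat; [apply Hu; lra|exact Hq2]).
  assert (HG : - q s3 <= - q s2 * exp (1 / 2 * (s3 - s2))).
  { apply (gronwall_le (fun s => - q s) (fun s => - (ddu s + 1 / 2 * du s))).
    - unfold s3; lra.
    - intros s Hs. destruct (radial_derivs s) as [H1 [H2 _]]; [lra|].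
      unfold q. auto_derive; [repeat split; eexists; eassumption|].
      subst_derive H1. subst_derive H2. ring.
    - intros s Hs. destruct (radial_derivs s) as [_ [_ ->]]; [lra|].
      destruct (Hd s) as [Hd1 Hd2]; [lra|].
      assert (Hus : 0 < u s) by (apply Hu; lra).
      assert ((INR N - 1) / s * du s <= 0).
      { assert (0 <= (INR N - 1) / s) by (apply Rle_div_r; lra). nra. }
      unfold q, force. nra. }
  assert (Hu3 : u s3 <= u s2).
  { apply (deriv_nonpos_le u du); [unfold s3; lra| |].
    - intros s Hs. apply radial_derivs; lra.
    - intros s Hs. left; apply Hd; lra. }
  assert (Hq3 : q s3 < 1 / 2 * u s3).
  { unfold q. destruct (Hd s3); [unfold s3; lra|]. lra. }
  pose proof (exp_ineq1 (1 / 2 * (s3 - s2))) as He.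
  assert (He' : 1 + 1 / 2 * (s3 - s2) < exp (1 / 2 * (s3 - s2))) by (apply He; unfold s3; lra).
  assert (HX : q s2 * (1 + 1 / 2 * (s3 - s2)) = q s2 + 1 / 2 * u s2) by (unfold s3; field; lra).
  nra. }
(* Past [2 * (r + 1)] the inequality [du <= - u / 2] makes [s^(r+1) * u] nonincreasing, whereas
   [Hlow] makes it at least [c * s]. *)
set (T := Rmax (Rmax S 1) (2 * (r + 1))).
assert (HT1 : S <= T) by (eapply Rle_trans; [|apply Rmax_l]; apply Rmax_l).
assert (HT2 : 1 <= T) by (eapply Rle_trans; [|apply Rmax_l]; apply Rmax_r).
assert (HT3 : 2 * (r + 1) <= T) by apply Rmax_r.
clearbody T.
set (P := fun s => Rpower s (r + 1) * u s).
set (s := T + P T / c).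
assert (HPT : 0 < P T) by (apply Rmult_lt_0_compat; [apply Rpower_pos|apply Hu; lra]).
assert (HPc : 0 < P T / c) by (apply Rdiv_lt_0_compat; auto).
assert (HP : P s <= P T).
{ apply (deriv_nonpos_le P (fun s => Rpower s r * ((r + 1) * u s + s * du s)));
    [unfold s; lra| |].
  - intros x Hx. assert (Hx0 : 0 < x) by lra. destruct (radial_derivs x Hx0) as [H1 _].
    pose proof (is_derive_Rpower (r + 1) x Hx0) as HR.
    unfold P. auto_derive; [repeat split; eexists; eassumption|].
    replace (Derive (fun x => Rpower x (r + 1)) x) with ((r + 1) * Rpower x r).
    2:{ symmetry; etransitivity; [exact (is_derive_unique _ _ _ HR)|].
        f_equal; f_equal; ring. }
    subst_derive H1. rewrite Rpower_S by lra. ring.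
  - intros x Hx. pose proof (Rpower_pos x r). pose proof (Hq x ltac:(lra)).
    pose proof (Hu x ltac:(lra)).
    assert ((r + 1) * u x + x * du x <= 0) by nra. nra. }
assert (HPs : c * s <= P s).
{ unfold P. rewrite Rpower_S by (unfold s; lra).
  pose proof (Hlow s ltac:(unfold s; lra)). assert (0 < s) by (unfold s; lra). nra. }
assert (c * s = c * T + P T) by (unfold s; field; lra).
nra.
Qed.

(** Suppose [u < 1] from some point on. There [s^(N-1) * du] is nondecreasing, so one point with
    [du >= 0] makes [u] nondecreasing from then on and traps it in [[u s0, 1)]. Otherwise [u]
    decreases: either it stays above [m], where [m^(p-1) = 1/2], and is trapped again, or it falls
    below [m] and [not_decaying] applies. *)
Lemma above_one_infinitely_often (S : R) : exists s, S < s /\ 0 < s /\ 1 < u s.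
Proof.
destruct (Classical_Prop.classic (exists s, S < s /\ 0 < s /\ 1 < u s)) as [H|H];
  [exact H|exfalso].
set (S0 := Rmax S 0). assert (HS1 : S <= S0) by apply Rmax_l.
assert (HS2 : 0 <= S0) by apply Rmax_r. clearbody S0.
assert (Hle : forall s, S0 < s -> u s <= 1).
{ intros s Hs. apply Rnot_lt_le. intro Hlt. apply H. exists s. lra. }
set (S1 := S0 + 1). assert (HS3 : 0 < S1) by (unfold S1; lra).
assert (Hlt : forall s, S1 <= s -> u s < 1).
{ unfold S1. intros s Hs. destruct (Hle s) as [Hs1|Hs1]; [lra|exact Hs1|exfalso].
  apply (no_rest_point s); [lra|auto|].
  apply (interior_min_critical s (s - 1 / 2) (s + 1 / 2) (-1)); [lra|lra| |lra].
  intros x Hx. pose proof (Hle x ltac:(lra)). lra. }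
clearbody S1.
assert (Hneg : forall s, S1 <= s -> du s < 0).
{ intros s0 Hs0. apply Rnot_le_lt. intro Hpos.
  set (m := INR N - 1).
  assert (Hdu : forall s, s0 <= s -> 0 <= du s).
  { intros s Hs.
    assert (HH : Rpower s0 m * du s0 <= Rpower s m * du s).
    { apply (deriv_nonneg_le (fun s => Rpower s m * du s)
        (fun s => Rpower s m * - force p 1 (u s))); [exact Hs| |].
      - intros x Hx. assert (Hx0 : 0 < x) by lra. destruct (radial_derivs x Hx0) as [H1 [H2 H3]].
        pose proof (is_derive_Rpower m x Hx0) as HR.
        auto_derive; [repeat split; eexists; eassumption|].
        replace (Derive (fun x => Rpower x m) x) with (m / x * Rpower x m).
        2:{ symmetry; etransitivity; [exact (is_derive_unique _ _ _ HR)|].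
            replace (Rpower x m) with (x * Rpower x (m - 1)); [field; lra|].
            rewrite <- Rpower_S by lra. f_equal; ring. }
        subst_derive H2. rewrite H3. unfold m. field. lra.
      - intros x Hx. apply Rmult_le_pos; [left; apply Rpower_pos|].
        assert (Hux : 0 < u x < 1) by (split; [apply Hu; lra|apply Hlt; lra]).
        assert (Rpower (u x) (p - 1) < 1).
        { rewrite <- (Rpower_base_1 (p - 1)) at 2. apply Rlt_Rpower_l; lra. }
        unfold force; nra. }
    pose proof (Rpower_pos s m). pose proof (Rpower_pos s0 m).
    assert (0 <= Rpower s0 m * du s0) by (apply Rmult_le_pos; lra). nra. }
  apply (not_trapped_below_one s0 (u s0)); [lra|apply Hu; lra|].
  intros s Hs. split; [|apply Hlt; lra].
  apply (deriv_nonneg_le u du); [lra| |].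
  - intros x Hx; apply radial_derivs; lra.
  - intros x Hx; apply Hdu; lra. }
set (m := Rpower (1 / 2) (/ (p - 1))).
assert (Hm : 0 < m) by apply Rpower_pos.
destruct (Classical_Prop.classic (exists s, S1 <= s /\ u s < m)) as [[s1 [Hs1 Hus1]]|Hno].
- apply (not_decaying s1); [lra|]. intros s Hs. split; [apply Hneg; lra|].
  assert (Hus : u s <= u s1).
  { apply (deriv_nonpos_le u du); [lra| |].
    - intros x Hx; apply radial_derivs; lra.
    - intros x Hx; left; apply Hneg; lra. }
  apply Rle_trans with (Rpower m (p - 1)).
  + apply Rle_Rpower_l; [lra|]. split; [apply Hu; lra|lra].
  + unfold m. rewrite Rpower_mult, Rinv_l, Rpower_1; lra.
- apply (not_trapped_below_one S1 m HS3 Hm). intros s Hs. split; [|apply Hlt, Hs].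
  apply Rnot_lt_le. intro Hlt'. apply Hno. exists s; auto.
Qed.

(** Rolle's argument between an upward crossing of 1 and the next downward one found. *)
Lemma critical_points_unbounded (S : R) : exists s, S < s /\ 0 < s /\ du s = 0.
Proof.
set (S0 := Rmax S 0). assert (HS1 : S <= S0) by apply Rmax_l.
assert (HS2 : 0 <= S0) by apply Rmax_r. clearbody S0.
destruct (below_one_infinitely_often S0) as [t1 [H1 [_ Hu1]]].
destruct (above_one_infinitely_often t1) as [t2 [H2 [_ Hu2]]].
destruct (below_one_infinitely_often t2) as [t3 [H3 [_ Hu3]]].
assert (Hcont : forall x, 0 < x -> continuity_pt u x).
{ intros x Hx. apply derivable_continuous_pt. exists (du x).
  apply is_derive_Reals, radial_derivs, Hx. }
destruct (IVT_interv (fun s => u s - 1) t1 t2) as [z1 [Hz1 Hz1']]; [|lra|lra|lra|].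
{ intros x Hx. apply (continuity_pt_minus u (fun _ => 1)); [apply Hcont; lra|reg]. }
destruct (IVT_interv (fun s => 1 - u s) t2 t3) as [z2 [Hz2 Hz2']]; [|lra|lra|lra|].
{ intros x Hx. apply (continuity_pt_minus (fun _ => 1) u); [reg|apply Hcont; lra]. }
assert (Hz12 : z1 < z2).
{ destruct (Req_dec z1 t2) as [->|]; [|lra]. exfalso; lra. }
destruct (MVT_cor2 u du z1 z2 Hz12) as [z [Hz Hz']].
{ intros x Hx. apply is_derive_Reals, radial_derivs; lra. }
exists z. split; [lra|]. split; [lra|].
assert (du z * (z2 - z1) = 0) by lra. nra.
Qed.

End Oscillation.

(** * Conclusion *)

(** [p > pS N] amounts to [(p - 1) * (N - 2) > 4], which is positive damping for
    [th = 2 / (p - 1)]. *)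
Lemma supercritical_exponents (N : nat) (p : R) : (3 <= N)%nat -> pS N < p ->
  exists th, 0 < th /\ th * (p - 1) = 2 /\ 1 < p /\ 0 < INR N - 2 - 2 * th.
Proof.
intros HN Hp. assert (HN3 : 3 <= INR N) by (apply (le_INR 3) in HN; simpl in HN; lra).
assert (H : 4 < (p - 1) * (INR N - 2)).
{ unfold pS in Hp. apply Rlt_div_l in Hp; lra. }
assert (Hp1 : 1 < p) by nra.
exists (2 / (p - 1)). split; [apply Rdiv_lt_0_compat; lra|].
split; [field; lra|]. split; [exact Hp1|].
assert (4 / (p - 1) < INR N - 2) by (apply Rlt_div_l; lra).
replace (2 * (2 / (p - 1))) with (4 / (p - 1)) by (field; lra). lra.
Qed.

Lemma unbounded_sequence (Z : R -> Prop) : (forall S, exists s, S < s /\ Z s) ->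
  exists sc : nat -> R, 0 < sc 0%nat /\ (forall k, sc k < sc (S k)) /\
    (forall M, exists k0, forall k, (k0 <= k)%nat -> M < sc k) /\ (forall k, Z (sc k)).
Proof.
intros HZ. destruct (choice _ HZ) as [next Hnext].
(* The [+ 1] yields [INR k < sc k]; strict increase alone would not exclude a finite limit. *)
set (sc := fix sc k := match k with O => next 0 | S k => next (sc k + 1) end).
assert (Hsc : forall k, INR k < sc k).
{ induction k as [|k IH]; [apply Hnext|]. rewrite S_INR.
  destruct (Hnext (sc k + 1)) as [H _]. change (sc (S k)) with (next (sc k + 1)). lra. }
exists sc. split; [apply Hnext|]. split; [|split].
- intros k. destruct (Hnext (sc k + 1)) as [H _].
  change (sc (S k)) with (next (sc k + 1)). lra.
- intros M. destruct (INR_above M) as [k0 Hk0]. exists k0. intros k Hk.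
  specialize (Hk0 k Hk). specialize (Hsc k). lra.
- intros [|k]; apply Hnext.
Qed.

Lemma singular_solution_limit (N : nat) (p th : R) (U : R -> R -> R) :
  (3 <= N)%nat -> 0 < th -> th * (p - 1) = 2 -> 1 < p -> 0 < INR N - 2 - 2 * th ->
  (forall gamma, 0 < gamma -> ivp_sol N p gamma (U gamma)) ->
  exists y v d, 0 < d /\
    ef_sol p (INR N - 2 - 2 * th) (th * (INR N - 2 - th)) y v /\
    (forall t, ham p (th * (INR N - 2 - th)) t (y t) (v t) <= - d) /\
    forall s b eps, s <= b -> 0 < eps -> exists G, forall g, G < g ->
      forall t, s <= t <= b -> Rabs (ef_y th (U g) t - y t) <= eps.
Proof.
intros HN Hth0 Hth Hp Hal HU.
assert (HN3 : 3 <= INR N) by (apply (le_INR 3) in HN; simpl in HN; lra).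
set (al := INR N - 2 - 2 * th) in *. set (a := th * (INR N - 2 - th)).
assert (Ha : 0 < a) by (apply Rmult_lt_0_compat; unfold al in Hal; lra).
(* [ivp_sol] only asserts that a derivative exists, whereas [family_limit] takes it as a function of
   the parameter, so one is chosen for every [gamma]. *)
destruct (choice (fun gamma du => 0 < gamma -> exists ddu,
  radial_ode N p (U gamma) du ddu /\
  forall eps, 0 < eps -> exists delta, 0 < delta /\ forall s, 0 < s < delta ->
    Rabs (U gamma s - gamma) < eps /\ Rabs (du s) < eps)) as [dU HdU].
{ intros gamma. destruct (Rlt_le_dec 0 gamma) as [Hg|Hg].
  - destruct (HU gamma Hg) as [_ [_ [du [ddu H]]]]. exists du. intros _. exists ddu. exact H.
  - exists (fun _ => 0). intros; lra. }
assert (HUpos : forall gamma s, 0 < gamma -> 0 < s -> 0 < U gamma s).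
{ intros gamma s Hg Hs. destruct (HU gamma Hg) as [_ [H _]]. apply H; lra. }
(* The three bounds serve, in order, the initial layer, the estimate of [s * u'] by [th * gamma],
   and the smallness of the power term. *)
set (ka := Rmin (INR N) (Rmin (th * INR N) ((p + 1) * th * al / 4))).
assert (Hka : 0 < ka).
{ repeat apply Rmin_glb_lt; [lra|apply Rmult_lt_0_compat; lra|].
  apply Rdiv_lt_0_compat; [|lra]. repeat apply Rmult_lt_0_compat; lra. }
assert (Hka1 : ka <= INR N) by apply Rmin_l.
assert (Hka2 : ka <= th * INR N) by (eapply Rle_trans; [apply Rmin_r|apply Rmin_l]).
assert (Hka3 : ka <= (p + 1) * th * al / 4) by (eapply Rle_trans; [apply Rmin_r|apply Rmin_r]).
clearbody ka.
set (d := th * al / 4 * (Rpower ka (th / 2) / 2) ^ 2).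
assert (Hd : 0 < d).
{ apply Rmult_lt_0_compat.
  - apply Rdiv_lt_0_compat; [apply Rmult_lt_0_compat; lra|lra].
  - apply pow_lt. pose proof (Rpower_pos ka (th / 2)). lra. }
set (A := Rpower a (/ (p - 1))).
assert (HA : Rpower A (p - 1) = a).
{ unfold A. rewrite Rpower_mult, Rinv_l, Rpower_1; lra. }
destruct (family_limit p al a A Hp Hal (Rpower_pos _ _) HA
  (fun g => ef_y th (U g)) (fun g => ef_v th (U g) (dU g)) d 2
  (fun g => (ln ka - (p - 1) * ln g) / 2)) as [y [v [Hef [Hham Hlim]]]].
- exact Hd.
- intros g Hg. destruct (HdU g) as [ddu [Hode _]]; [lra|].
  apply (ef_sol_of_radial N p th (U g) (dU g) ddu Hth); [|exact Hode].
  intros s Hs; apply HUpos; lra.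
- intros g t Hg Ht. destruct (HdU g) as [ddu [Hode Hl]]; [lra|].
  apply (ivp_ham N p th g ka (U g) (dU g) ddu); auto; [lra|].
  intros s Hs; apply HUpos; lra.
- intros t. exists (exp ((ln ka - 2 * t) / (p - 1))). intros g Hg.
  assert (H : (ln ka - 2 * t) / (p - 1) < ln g).
  { rewrite <- (ln_exp ((ln ka - 2 * t) / (p - 1))). apply ln_increasing; [apply exp_pos|auto]. }
  apply Rlt_div_l in H; lra.
- exists y, v, d. auto.
Qed.

Theorem theorem1p1 (N : nat) (p : R) (U : R -> R -> R)
  (HN : (3 <= N)%nat) (Hp : pS N < p)
  (HU : forall gamma, 0 < gamma -> ivp_sol N p gamma (U gamma)) :
  exists ustar du ddu : R -> R,
    (* positive C^2 solution on (0,oo) *)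
    (forall s, 0 < s -> 0 < ustar s) /\
    radial_ode N p ustar du ddu /\
    (* u*(s) -> oo as s -> 0+ *)
    (forall M, exists delta, 0 < delta /\
       forall s, 0 < s < delta -> M < ustar s) /\
    (* u* oscillates around 1 *)
    (forall S, exists s t, S < s /\ S < t /\ 0 < s /\ 0 < t /\
       ustar s < 1 /\ 1 < ustar t) /\
    (* infinitely many critical points 0 < s_1 < s_2 < ... -> oo *)
    (exists sc : nat -> R,
       0 < sc 0%nat /\
       (forall k, sc k < sc (S k)) /\
       (forall M, exists k0, forall k, (k0 <= k)%nat -> M < sc k) /\
       (forall k, du (sc k) = 0)) /\
    (* u(.,gamma) -> u* in C^0_loc(0,oo) as gamma -> oo *)
    (forall a b, 0 < a -> a <= b -> forall eps, 0 < eps ->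
       exists G, forall gamma, G < gamma -> 0 < gamma ->
         forall s, a <= s <= b -> Rabs (U gamma s - ustar s) < eps).
Proof.
destruct (supercritical_exponents N p HN Hp) as [th [Hth0 [Hth [Hp1 Hal]]]].
destruct (singular_solution_limit N p th U HN Hth0 Hth Hp1 Hal HU)
  as [y [v [d [Hd [Hef [Hham Hlim]]]]]].
set (al := INR N - 2 - 2 * th) in *. set (a := th * (INR N - 2 - th)) in *.
assert (Ha : 0 < a) by (apply Rmult_lt_0_compat; unfold al in Hal; lra).
assert (HA : Rpower (Rpower a (/ (p - 1))) (p - 1) = a).
{ rewrite Rpower_mult, Rinv_l, Rpower_1; lra. }
destruct (radial_of_ef_sol N p th y v Hth Hef) as [du [ddu Hode]].
set (u := fun s => exp (- th * ln s) * y (ln s)) in *.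
assert (Hu : forall s, 0 < s -> 0 < u s).
{ intros s _. apply Rmult_lt_0_compat; [apply exp_pos|apply (Hef (ln s))]. }
assert (Hsing : forall M, exists delta, 0 < delta /\ forall s, 0 < s < delta -> M < u s).
{ intros M.
  destruct (ham_box p a _ Hp1 (Rpower_pos _ _) HA 0 d Hd) as [m [M' [Hm [_ Hbox]]]].
  assert (HM : 0 < (Rabs M + 1) / m).
  { pose proof (Rabs_pos M). apply Rdiv_lt_0_compat; lra. }
  set (T := Rmin 0 (- ln ((Rabs M + 1) / m) / th)).
  exists (exp T). split; [apply exp_pos|]. intros s [Hs HsT].
  assert (Hls : ln s < T) by (rewrite <- (ln_exp T); apply ln_increasing; auto).
  assert (HT1 : T <= 0) by apply Rmin_l.
  assert (HT2 : T <= - ln ((Rabs M + 1) / m) / th) by apply Rmin_r.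
  destruct (Hbox (ln s) (y (ln s)) (v (ln s))) as [[Hy _] _];
    [lra|apply Hef|apply Hham|].
  assert (HE : (Rabs M + 1) / m < exp (- th * ln s)).
  { rewrite <- (exp_ln ((Rabs M + 1) / m)) by exact HM. apply exp_increasing.
    apply Rle_div_r in HT2; [|exact Hth0]. nra. }
  apply Rlt_div_l in HE; [|exact Hm].
  pose proof (Rle_abs M). pose proof (exp_pos (- th * ln s)). unfold u. nra. }
(* Dropping nonnegative terms, [ham <= - d] leaves [2 * d <= (a + s^2) * y^2], which is at most
   [(a + 1) * (s * y)^2] for [s >= 1]; and [s * y = s^(th+1) * u]. *)
set (c := sqrt (2 * d / (a + 1))).
assert (Hc2 : 0 < 2 * d / (a + 1)) by (apply Rdiv_lt_0_compat; lra).
assert (Hc : 0 < c) by (apply sqrt_lt_R0, Hc2).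
assert (Hlow : forall s, 1 <= s -> c <= Rpower s (th + 1) * u s).
{ intros s Hs. specialize (Hham (ln s)). destruct (Hef (ln s)) as [Hy _].
  assert (Hyu : Rpower s (th + 1) * u s = s * y (ln s)).
  { rewrite Rpower_S by lra. unfold u, Rpower. rewrite !Rmult_assoc. f_equal.
    rewrite <- Rmult_assoc, <- exp_plus.
    replace (th * ln s + - th * ln s) with 0 by ring. rewrite exp_0; ring. }
  rewrite Hyu. unfold c.
  rewrite <- (sqrt_pow2 (s * y (ln s))) by (apply Rmult_le_pos; lra).
  apply sqrt_le_1_alt. apply Rle_div_l; [lra|].
  unfold ham, potential in Hham.
  assert (HP : 0 < Rpower (y (ln s)) (p + 1) / (p + 1)).
  { apply Rdiv_lt_0_compat; [apply Rpower_pos|lra]. }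
  replace (exp (2 * ln s)) with (s ^ 2) in Hham.
  2:{ rewrite <- (exp_ln s) at 1 by lra. simpl. rewrite Rmult_1_r, <- exp_plus.
      f_equal; ring. }
  rewrite Rpow_mult_distr. pose proof (pow2_ge_0 (v (ln s))).
  pose proof (pow2_ge_0 (y (ln s))).
  assert (1 <= s ^ 2) by nra.
  assert (2 * d <= a * y (ln s) ^ 2 + s ^ 2 * y (ln s) ^ 2) by lra.
  assert (a * y (ln s) ^ 2 <= s ^ 2 * (a * y (ln s) ^ 2)).
  { rewrite <- (Rmult_1_l (a * y (ln s) ^ 2)) at 1. apply Rmult_le_compat_r; [|lra].
    apply Rmult_le_pos; lra. }
  lra. }
assert (HN2 : (2 <= N)%nat) by lia.
exists u, du, ddu. split; [exact Hu|]. split; [exact Hode|]. split; [exact Hsing|].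
split; [|split].
- intros S.
  destruct (below_one_infinitely_often N p u du ddu HN2 Hp1 Hu Hode Hsing S) as [s [H1 [H2 H3]]].
  destruct (above_one_infinitely_often N p (th + 1) c u du ddu HN2 Hp1 Hc Hu Hode Hsing Hlow S)
    as [t [H4 [H5 H6]]].
  exists s, t. repeat split; assumption.
- apply (unbounded_sequence (fun s => du s = 0)). intros S.
  destruct (critical_points_unbounded N p (th + 1) c u du ddu HN2 Hp1 Hc Hu Hode Hsing Hlow S)
    as [s [H1 [_ H2]]].
  exists s; auto.
- intros s0 b Hs0 Hsb eps Heps.
  assert (Hln : forall x z, 0 < x -> x <= z -> ln x <= ln z).
  { intros x z Hx [Hxz| ->]; [left; apply ln_increasing; auto|lra]. }
  pose proof (exp_pos (- th * ln s0)) as HE.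
  (* The factor [s^(- th)] between [y] and [u] is largest at the left end [s0]; the tolerance
     absorbs it, and the 2 makes the final inequality strict. *)
  destruct (Hlim (ln s0) (ln b) (eps / (2 * exp (- th * ln s0)))) as [G HG].
  { apply Hln; lra. }
  { apply Rdiv_lt_0_compat; lra. }
  exists G. intros gamma Hg _ s Hs.
  specialize (HG gamma Hg (ln s)).
  assert (Hs' : ln s0 <= ln s <= ln b) by (split; apply Hln; lra).
  specialize (HG Hs'). unfold ef_y in HG. rewrite exp_ln in HG by lra.
  replace (U gamma s - u s)
    with (exp (- th * ln s) * (exp (th * ln s) * U gamma s - y (ln s))).
  2:{ unfold u. rewrite Rmult_minus_distr_l, <- Rmult_assoc, <- exp_plus.
      replace (- th * ln s + th * ln s) with 0 by ring. rewrite exp_0; ring. }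
  pose proof (exp_pos (- th * ln s)) as HEs.
  assert (HEE : exp (- th * ln s) <= exp (- th * ln s0)).
  { destruct (Req_dec (ln s) (ln s0)) as [->|Hne]; [lra|].
    left; apply exp_increasing. nra. }
  rewrite Rabs_mult, (Rabs_pos_eq (exp (- th * ln s))) by lra.
  apply Rle_lt_trans with (exp (- th * ln s0) * (eps / (2 * exp (- th * ln s0)))).
  + apply Rmult_le_compat; try lra. apply Rabs_pos.
  + replace (exp (- th * ln s0) * (eps / (2 * exp (- th * ln s0)))) with (eps / 2)
      by (field; lra). lra.
Qed.
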